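(* Let $\mu$ be a probability measure on $\mathbb{C}$, and let $\{a_k\}_{k\ge 1}$ and $\{b_k\}_{k\ge 1}$ be two $\mu$-distributed and log-Cesàro bounded sequences of complex numbers such that $a_k\neq b_k$ for infinitely many $k$. Let $\{\xi_k\}_{k\ge1}$ be independent random variables such that, for each $k\geq 1$, $\xi_k=a_k$ or $\xi_k=b_k$ with equal probability. Define $P_n(z):=(z-\xi_1)(z-\xi_2)\cdots(z-\xi_n)$. Then $\mathscr{M}(P_n)\xrightarrow{w}\mu$ almost surely and $\mathscr{M}(P_n')\xrightarrow{w}\mu$ in probability, as $n\to\infty$.
   Context: For a nonconstant complex polynomial $P$, $\mathscr{M}(P)$ denotes the uniform probability measure on the multiset of zeros of $P$ (zeros counted with multiplicity); $P'$ is the derivative ($n\ge 2$ when $P_n'$ is considered). A sequence of probability measures $\mu_n$ on $\mathbb{C}$ converges weakly to a probability measure $\mu$ (written $\mu_n\xrightarrow{w}\mu$) if $\int f\,d\mu_n\to\int f\,d\mu$ for every $f\in C_c^\infty(\mathbb{C})$. For random probability measures $\mu_n$: $\mu_n\xrightarrow{w}\mu$ in probability means $\lim_{n\to\infty}\mathbb{P}(\mu_n\in N)=1$ for every neighbourhood $N$ of $\mu$ in the weak topology; $\mu_n\xrightarrow{w}\mu$ almost surely means that with probability one $\mu_n\to\mu$ weakly. A sequence $\{a_n\}_{n\ge1}$ of complex numbers is $\mu$-distributed if $\frac1n\sum_{i=1}^n\delta_{a_i}\xrightarrow{w}\mu$. It is log-Cesàro bounded if the sequence $\left\{\frac1n\sum_{i=1}^n\log_+|a_i|\right\}_{n\ge1}$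 is bounded, where $\log_+x=\max(\log x,0)$ (with $\log_+0=0$). *)

(* Defs.v *)
From HB Require Import structures.
From mathcomp Require Import all_boot all_order all_algebra.
From mathcomp Require Import complex.
From mathcomp Require Import all_classical all_reals all_analysis.

Set Implicit Arguments.
Unset Strict Implicit.
Unset Printing Implicit Defensive.

Import Order.TTheory GRing.Theory Num.Theory.
Import numFieldNormedType.Exports.

Local Open Scope classical_set_scope.
Local Open Scope ring_scope.

(* The complex plane is [Rcomplex R], the copy of [R[i]] whose modulus takes
   values in [R] and which is an [R]-vector space. It inherits the algebraically
   closed field structure of [R[i]]; the library leaves it without topology and
   sigma-algebra, so it gets here the metric topology of the modulus and the
   Borel sigma-algebra. *)
HB.instance Definition _ (R : realType) :=
  PseudoMetric.copy (Rcomplex R) (pseudoMetric_normed (Rcomplex R)).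
HB.instance Definition _ (R : realType) :=
  isPointed.Build (Rcomplex R) 0.
HB.instance Definition _ (R : realType) :=
  NormedZmod_PseudoMetric_eq.Build R (Rcomplex R) erefl.

Lemma Rcomplex_normrZ (R : realType) (l : R) (x : Rcomplex R) :
  `|l *: x| = `|l| * `|x|.
Proof.
case: x => x y; rewrite /Num.norm /= !exprMn -mulrDr.
by rewrite sqrtrM ?sqr_ge0// sqrtr_sqr.
Qed.

HB.instance Definition _ (R : realType) :=
  PseudoMetricNormedZmod_Lmodule_isNormedModule.Build R (Rcomplex R)
    (@Rcomplex_normrZ R).

HB.instance Definition _ (R : realType) :=
  Measurable.copy (Rcomplex R)
    (g_sigma_algebraType (@open (Rcomplex R))).

Section test_functions.
Variable R : realType.
Implicit Types f : Rcomplex R -> R^o.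

(* [Ck k f]: all iterated partial derivatives of [f] of order at most [k], with
   respect to the real and imaginary parts of the variable, exist and are
   continuous on the whole plane. *)
Fixpoint Ck (k : nat) f : Prop :=
  if k is j.+1 then
    [/\ continuous f,
        forall z, derivable f z (Complex 1 0 : Rcomplex R),
        forall z, derivable f z (Complex 0 1 : Rcomplex R),
        Ck j (fun z => 'D_(Complex 1 0 : Rcomplex R) f z) &
        Ck j (fun z => 'D_(Complex 0 1 : Rcomplex R) f z)]
  else continuous f.

Definition test_function f : Prop :=
  (forall k, Ck k f) /\ compact (closure [set z | f z != 0]).

End test_functions.

Lemma cvg_initial (S : choiceType) (T : topologicalType) (f : S -> T)
    (F : set_system S) (s : S) : Filter F ->
  (F --> (s : initial_topology f)) <-> f @ F --> f s.
Proof.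
move=> FF; split=> [Fs|Ffs].
  have cf := @initial_continuous S T f s.
  by move=> A /cf /Fs.
move=> N; rewrite nbhsE => -[B [[A oA <-] As] BN].
have /Ffs : nbhs (f s) A by exact: open_nbhs_nbhs.
by rewrite /= /nbhs /=; apply: filterS => x; exact: BN.
Qed.

Section weak_convergence.
Variable R : realType.
Local Notation C := (Rcomplex R).

Definition weak_cvg (nu : nat -> probability C R) (mu : probability C R) : Prop :=
  forall f : C -> R, test_function f ->
    (\int[nu n]_z f z) @[n --> \oo] --> \int[mu]_z f z.

Definition weak_pairing (nu : probability C R)
    : {ptws {f : C -> R | test_function f} -> R} :=
  fun f => \int[nu]_z sval f z.

(* The weak topology: the coarsest topology on the probability measures making
   [fun nu => \int[nu]_z f z] continuous for every test function [f]. *)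
Definition weak_space : topologicalType := initial_topology weak_pairing.

Lemma weak_cvgP (nu : nat -> probability C R) (mu : probability C R) :
  weak_cvg nu mu <-> (nu : nat -> weak_space) @ \oo --> (mu : weak_space).
Proof.
rewrite (@cvg_initial _ _ weak_pairing); split=> [cvg_nu|cvg_nu f tf].
  by apply/cvg_sup => -[f tf]; apply/cvg_initial; exact: cvg_nu.
by move/cvg_sup : cvg_nu => /(_ (exist _ f tf)) /cvg_initial.
Qed.

Section random_measures.
Context d (Omega : measurableType d) (P : probability Omega R).

Definition weak_cvg_as (nu : nat -> Omega -> probability C R)
    (mu : probability C R) : Prop :=
  {ae P, forall w, weak_cvg (nu ^~ w) mu}.

(* [N] is an arbitrary neighbourhood, so the event [nu n \in N] need not be
   measurable; its probability is then read as inner probability, i.e. bounded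
   below by that of measurable events [E n] it contains. When the events are
   measurable this says that [P (nu n @^-1` N)] tends to 1. *)
Definition weak_cvg_in_probability (nu : nat -> Omega -> probability C R)
    (mu : probability C R) : Prop :=
  forall N : set weak_space, nbhs (mu : weak_space) N ->
    exists E : nat -> set Omega,
      [/\ forall n, measurable (E n),
          forall n, E n `<=` nu n @^-1` N &
          P (E n) @[n --> \oo] --> 1%E].

End random_measures.
End weak_convergence.

Section empirical_measures.
Variable R : realType.
Local Notation C := (Rcomplex R).

(* Uniform probability measure on the multiset of the entries of [s]; the last
   argument of [mnormalize] is a dummy value for [s = [::]]. *)
Definition empirical (s : seq C) : probability C R :=
  mnormalize (msum (fun i => \d_(s`_i)) (size s)) \d_(0 : C).

Definition zeros (p : {poly C}) : seq C := sval (closed_field_poly_normal p).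

Definition zero_measure (p : {poly C}) : probability C R := empirical (zeros p).

(* Sequences start at index 0, so the first [n] terms are [a 0, ..., a n.-1]. *)
Definition distributed (mu : probability C R) (a : nat -> C) : Prop :=
  weak_cvg (fun n => empirical (mkseq a n)) mu.

(* [log_plus 0 = 0] because [ln] vanishes on nonpositive reals. *)
Definition log_plus (x : R) : R := Num.max (ln x) 0.

Definition log_cesaro_bounded (a : nat -> C) : Prop :=
  bounded_fun (fun n : nat => (n.+1)%:R^-1 * \sum_(i < n.+1) log_plus `|a i| : R^o).

End empirical_measures.

Definition independent_RVs d d' (Omega : measurableType d) (T : measurableType d')
    (R : realType) (P : probability Omega R) (X : nat -> {RV P >-> T}) : Prop :=
  forall (s : seq nat) (A : nat -> set T), uniq s ->
    (forall i, measurable (A i)) ->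
    P (\bigcap_(i in [set` s]) X i @^-1` A i) =
    (\prod_(i <- s) P (X i @^-1` A i))%E.

(* The law of [X] is [(\d_a + \d_b) / 2]; for [a = b] this says [X = a] almost
   surely. *)
Definition equally_likely d (Omega : measurableType d) (R : realType)
    (P : probability Omega R) (X : {RV P >-> Rcomplex R}) (a b : Rcomplex R) : Prop :=
  forall A : set (Rcomplex R), measurable A ->
    distribution P X A = (2^-1%:E * (\d_a A + \d_b A))%E.

(* Main.v *)
(** With probability one, [n^-1 \sum_(k < n) f (xi k)] follows its mean
    [n^-1 \sum_(k < n) (f (a k) + f (b k)) / 2], which tends to [\int f dmu]: fourth moments
    and Borel-Cantelli give this for the indicators of all grid cells at once, and
    test functions are uniform limits of finite combinations of such indicators.

    For the critical points, Green's formula with a regularized logarithm bounds the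
    difference of the sums of a test function over the zeros of [P_n'] and of [P_n] by the
    integral over a box of [|ln |P_n'| - ln |P_n||]. The quotient
    [P_n' / P_n = \sum_k (z - xi k)^-1] is a sum of independent variables infinitely many of
    which are nondegenerate, so by a Littlewood-Offord type estimate it is, for almost every
    [z], smaller than [exp (- eps n)] with probability tending to 0. Away from this event the
    logarithm of the quotient is at least [- eps n]; on it, it is bounded below through
    [\sum_k ln_+ |xi k| = O(n)], the contribution of the singularities of the logarithms
    being absorbed by an integrable function of the real part alone. Hence the average
    of the difference is [o(n)]. *)

Require Import Defs.
From mathcomp Require Import all_boot all_order all_algebra.
From mathcomp Require Import finmap complex.
From mathcomp Require Import all_classical all_reals all_analysis.
From mathcomp Require Import measurable_realfun ring lra zify.
Import Order.TTheory GRing.Theory Num.Theory.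
Import numFieldNormedType.Exports.
Local Open Scope classical_set_scope.
Local Open Scope ring_scope.

Set Implicit Arguments.
Unset Strict Implicit.
Unset Printing Implicit Defensive.

(** * Uniform choices between two sequences *)

(** [avg a b n G] is the expectation of [G] at the first [n] variables, so moments, concentration
    and averages over critical points are statements on finite lists; Omega is reached through
    [choices_event]. The obstacle is that nothing is known about the location of the zeros of
    [P_n']. Every estimate is therefore uniform in the position of a singularity: the mollification
    error does not depend on the centre, and the singularity of ln |z - x| is controlled by |Re z -
    Re x| ^ (-1/2), whose integral over a box is bounded independently of x. Its coefficient can be
    made as small as desired, which compensates for the 2n - 1 singularities. The upper bound on ln
    |P_n' / P_n| is deterministic; only the lower one needs anti-concentration. That is uniform in
    n: once K steps have made all atoms of the sum small, later steps only translate. The threshold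
    exp (- eps n) drops below any fixed radius, yet costs only eps after division by n. *)

Section choices.
Context {R : realType} {T : eqType} (a b : nat -> T).

(** The list has [2 ^ n] entries, with repetitions when [a k = b k], so that [avg] is always an
    expectation under [n] fair coin tosses. New entries go to the end, which makes [avgS] a
    conditioning on the last toss. *)
Fixpoint choices (n : nat) : seq (seq T) :=
  if n is m.+1 then
    [seq rcons s (a m) | s <- choices m] ++ [seq rcons s (b m) | s <- choices m]
  else [:: [::]].

Definition avg (n : nat) (G : seq T -> R) : R :=
  2^-1 ^+ n * \sum_(s <- choices n) G s.

Lemma avg0 G : avg 0 G = G [::].
Proof. by rewrite /avg expr0 mul1r big_seq1. Qed.

Lemma avgS n G : avg n.+1 G =
  2^-1 * (avg n (fun s => G (rcons s (a n))) + avg n (fun s => G (rcons s (b n)))).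
Proof. by rewrite /avg /= big_cat !big_map exprS -mulrA mulrDr. Qed.

Lemma choicesP n s : s \in choices n ->
  size s = n /\ forall x0 k, (k < n)%N -> nth x0 s k = a k \/ nth x0 s k = b k.
Proof.
elim: n s => [|n IHn] s /=; first by rewrite inE => /eqP ->.
rewrite mem_cat => /orP[] /mapP[s' /IHn [ss' Hs'] ->];
  rewrite size_rcons ss'; split => // x0 k; rewrite ltnS nth_rcons ss';
  by case: ltngtP => // [+ _|-> _]; [exact: Hs'|by [left|right]].
Qed.

Lemma eq_avg n G H : (forall s, s \in choices n -> G s = H s) ->
  avg n G = avg n H.
Proof. by move=> GH; congr (_ * _); apply: eq_big_seq. Qed.

Lemma le_avg n G H : (forall s, s \in choices n -> G s <= H s) ->
  avg n G <= avg n H.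
Proof.
move=> GH; apply: ler_wpM2l; first by rewrite exprn_ge0.
by rewrite big_seq [leRHS]big_seq; apply: ler_sum.
Qed.

Lemma avgD n G H : avg n (fun s => G s + H s) = avg n G + avg n H.
Proof. by rewrite /avg big_split mulrDr. Qed.

Lemma avgZ n c G : avg n (fun s => c * G s) = c * avg n G.
Proof. by rewrite /avg -mulr_sumr mulrCA. Qed.

Lemma avg_sum I (r : seq I) n G :
  avg n (fun s => \sum_(i <- r) G i s) = \sum_(i <- r) avg n (G i).
Proof. by rewrite /avg exchange_big mulr_sumr. Qed.

Lemma avg_cst n c : avg n (fun=> c) = c.
Proof. by elim: n => [|n IHn]; rewrite ?avg0// avgS IHn; lra. Qed.

Lemma avg_ge0 n G : (forall s, 0 <= G s) -> 0 <= avg n G.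
Proof. by move=> G0; rewrite -(avg_cst n 0) le_avg. Qed.

Lemma avg_markov n (G : seq T -> R) e : 0 < e -> (forall s, 0 <= G s) ->
  avg n (fun s => (e <= G s)%R%:R) <= avg n G / e.
Proof.
move=> e0 G0; rewrite mulrC -avgZ; apply: le_avg => s _.
case: (leP e (G s)) => h /=; last by rewrite mulr_ge0// invr_ge0 ltW.
by rewrite ler_pdivlMl// mulr1.
Qed.

Section moments.
Variables (f : T -> R) (M : R).
Hypothesis fM : forall x, `|f x| <= M.
Let m k := 2^-1 * (f (a k) + f (b k)).
Let S n s := \sum_(x <- s) f x - \sum_(k < n) m k.
Let d k := 2^-1 * (f (a k) - f (b k)).

Let SSa n s : S n.+1 (rcons s (a n)) = S n s + d n.
Proof. by rewrite /S big_rcons big_ord_recr /m /d /=; lra. Qed.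

Let SSb n s : S n.+1 (rcons s (b n)) = S n s - d n.
Proof. by rewrite /S big_rcons big_ord_recr /m /d /=; lra. Qed.

Let d2 n : d n ^+ 2 <= M ^+ 2.
Proof.
rewrite -ler_sqrt; last by rewrite sqr_ge0.
rewrite !sqrtr_sqr [leRHS]ger0_norm; last exact: le_trans (fM (a 0)).
rewrite /d; have := fM (a n); have := fM (b n); rewrite !ler_norml; lra.
Qed.

Lemma avg_centered_sum2 n : avg n (fun s => S n s ^+ 2) <= n%:R * M ^+ 2.
Proof.
elim: n => [|n IHn]; first by rewrite avg0 /S big_nil big_ord0 subrr mul0r expr0n.
rewrite avgS -avgD.
rewrite (@eq_avg _ _ (fun s => 2 * (S n s ^+ 2 + d n ^+ 2))); last first.
  by move=> s _; rewrite SSa SSb; ring.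
rewrite avgZ avgD avg_cst mulrA mulVf ?pnatr_eq0// mul1r -natr1 mulrDl mul1r.
exact: lerD.
Qed.

(** Odd powers of [d n] cancel in the average, leaving the increment [6 d^2 S^2 + d^4]. The order
    [n ^ 2] makes Markov's bound at scale [n] of order [n ^ -2], hence summable, whereas second
    moments give only [n ^ -1]. *)
Lemma avg_centered_sum4 n :
  avg n (fun s => S n s ^+ 4) <= 3 * n%:R ^+ 2 * M ^+ 4.
Proof.
elim: n => [|n IHn].
  by rewrite avg0 /S big_nil big_ord0 subrr !expr0n/= mulr0 mul0r.
rewrite avgS -avgD.
rewrite (@eq_avg _ _
  (fun s => 2 * (S n s ^+ 4 + (6 * d n ^+ 2 * S n s ^+ 2 + d n ^+ 4)))); last first.
  by move=> s _; rewrite SSa SSb; ring.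
rewrite avgZ 2!avgD avgZ avg_cst mulrA mulVf ?pnatr_eq0// mul1r -[n.+1%:R]natr1.
have h2 := d2 n; have h3 := avg_centered_sum2 n.
have s2 : 0 <= avg n (fun s => S n s ^+ 2) by apply: avg_ge0 => s; rewrite sqr_ge0.
have h4 : d n ^+ 4 <= M ^+ 4.
  by rewrite !(exprM _ 2 2) lerXn2r// nnegrE sqr_ge0.
have h5 : d n ^+ 2 * avg n (fun s => S n s ^+ 2) <= M ^+ 2 * (n%:R * M ^+ 2).
  by apply: ler_pM => //; rewrite sqr_ge0.
(* [3 (n + 1) ^ 2] exceeds [3 n ^ 2] by [6 n + 3]: the [6 n] pays for the variance term and the [3]
   for [d n ^+ 4]. *)
have -> : 3 * (n%:R + 1) ^+ 2 * M ^+ 4 =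
  3 * n%:R ^+ 2 * M ^+ 4 + (6 * (M ^+ 2 * (n%:R * M ^+ 2)) + 3 * M ^+ 4) by ring.
have : 0 <= M ^+ 4 by rewrite (exprM _ 2 2) sqr_ge0.
rewrite -mulrA; nra.
Qed.

End moments.
End choices.

(** * From averages over choices to events of the probability space *)

Section choice_event.
Context {R : realType}.
Local Notation C := (Rcomplex R).

Lemma measurable_set1_Rcomplex (x : C) : measurable [set x].
Proof.
rewrite -[X in measurable X]setCK; apply: measurableC.
apply: sub_sigma_algebra; apply: closed_openC.
exact: accessible_closed_set1 (hausdorff_accessible (@norm_hausdorff _ C)) x.
Qed.

Context d (Omega : measurableType d) (P : probability Omega R)
  (a b : nat -> C) (xi : nat -> {RV P >-> C}).
Hypothesis (xi_indep : independent_RVs xi)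
  (xi_law : forall k, equally_likely (xi k) (a k) (b k)).

Let cell n (c : seq C) := \bigcap_(k in [set` iota 0 n]) xi k @^-1` [set nth 0 c k].

Let cellE n c : cell n c = [set w | forall k, (k < n)%N -> xi k w = nth 0 c k].
Proof.
apply/seteqP; split => w /= h k; last by rewrite /= mem_iota => /andP[_ kn]; exact: h.
by move=> kn; apply: (h k); rewrite /= mem_iota.
Qed.

(** Independence gives a product over [k] of half the number of equalities among [a k = c k] and
    [b k = c k]; peeling off the last factor is the recursion [avgS]. *)
Let P_cell n c : size c = n -> P (cell n c) = (avg a b n (fun s => (s == c)%:R))%:E.
Proof.
move=> sc; rewrite /cell xi_indep ?iota_uniq//; last first.
  by move=> i; exact: measurable_set1_Rcomplex.
rewrite (_ : avg _ _ _ _ = \prod_(k <- iota 0 n)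
    (2^-1 * ((a k == nth 0 c k)%:R + (b k == nth 0 c k)%:R))).
  elim: (iota 0 n) => [|k r IHr]; first by rewrite !big_nil.
  rewrite !big_cons EFinM IHr; congr (_ * _)%E.
  have := xi_law k (measurable_set1_Rcomplex (nth 0 c k)).
  rewrite /distribution /pushforward => ->.
  rewrite !diracE EFinM EFinD; congr (_ * (_%:E + _%:E))%E.
  - by congr (_%:R); congr nat_of_bool; apply/idP/idP => [/set_mem ->//|/eqP ->];
      rewrite ?mem_set.
  - by congr (_%:R); congr nat_of_bool; apply/idP/idP => [/set_mem ->//|/eqP ->];
      rewrite ?mem_set.
elim: n c sc => [|n IHn] c; first by move/size0nil => ->; rewrite avg0 big_nil eqxx.
case/lastP: c => // c x; rewrite size_rcons => -[sc].
have -> : iota 0 n.+1 = rcons (iota 0 n) n by rewrite -cats1 -addn1 iotaD.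
rewrite big_rcons nth_rcons sc ltnn eqxx avgS.
rewrite (eq_big_seq (fun k => 2^-1 * ((a k == nth 0 c k)%:R + (b k == nth 0 c k)%:R)));
  last by move=> k; rewrite mem_iota /= add0n => kn; rewrite nth_rcons sc kn.
rewrite -IHn//.
under eq_avg do rewrite eqseq_rcons -mulnb mulnC natrM.
under [X in _ + X]eq_avg do rewrite eqseq_rcons -mulnb mulnC natrM.
by rewrite !avgZ /=; ring.
Qed.

(** [E] is a finite union of disjoint cylinders, hence measurable whatever [good] is. The law fixes
    the values of [xi] only almost surely, so [E] implies [good] without being equivalent to it, but
    its probability is the exact average. *)
Lemma choices_event n (good : pred (seq C)) : exists E : set Omega,
  [/\ measurable E, forall w, E w -> good (mkseq (fun k => xi k w) n) &
      P E = (avg a b n (fun s => (good s)%:R))%:E].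
Proof.
(* Duplicates are removed to make the cells disjoint; the multiplicity of a sequence is already
   counted in [P_cell]. *)
pose V := undup [seq s <- choices a b n | good s].
have mcell c : measurable (cell n c).
  apply: fin_bigcap_measurable => // k _.
  by rewrite -[X in measurable X]setTI; apply: measurable_funP => //;
    exact: measurable_set1_Rcomplex.
have sV c : c \in V -> size c = n.
  by rewrite mem_undup mem_filter => /andP[_ /choicesP[]].
exists (\bigcup_(c in [set` V]) cell n c); split.
- exact: fin_bigcup_measurable.
- move=> w [c /= cV]; rewrite cellE /= => wc.
  suff -> : mkseq (fun k => xi k w) n = c.
    by move: cV; rewrite mem_undup mem_filter => /andP[].
  apply: (@eq_from_nth _ 0); first by rewrite size_mkseq sV.
  by move=> k; rewrite size_mkseq => kn; rewrite nth_mkseq// wc.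
have fV : finite_set [set` V] by exact: finite_seq.
rewrite measure_fin_bigcup//; last first.
  move=> c c' /= cV c'V [w]; rewrite !cellE /= => -[wc wc'].
  apply: (@eq_from_nth _ 0); first by rewrite !sV.
  by move=> k; rewrite sV// => kn; rewrite -wc// wc'.
rewrite -fsbig_seq ?undup_uniq//=.
rewrite big_seq (eq_bigr (fun c => (avg a b n (fun s => (s == c)%:R))%:E)); last first.
  by move=> c cV; rewrite P_cell// sV.
rewrite sumEFin -big_seq -avg_sum; congr (_%:E); apply: eq_avg => s sn.
have [sg|sg] := boolP (good s).
  have sV' : s \in V by rewrite mem_undup mem_filter sg.
  rewrite (bigD1_seq s)//= ?undup_uniq// eqxx big1 ?addr0// => c.
  by rewrite eq_sym => /negbTE ->.
rewrite big1_seq// => c /andP[_]; rewrite mem_undup mem_filter => /andP[gc _].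
by case: eqP => // sc; rewrite sc gc in sg.
Qed.

End choice_event.

(** * A Littlewood-Offord type estimate *)

Section littlewood_offord.
Context {R : realType} {V : normedModType R} (a b : nat -> V).

(** [U] and [I] are the union and the intersection of [W - x] and [W - y]. Trading two translates of
    equal size for two nested sets of unequal sizes is what makes concentration decrease. *)
Lemma translate_fset (x y : V) (W : {fset V}) :
  x != y -> W != fset0%fset ->
  exists U I : {fset V},
    [/\ (#|` U| + #|` I| = 2 * #|` W|)%N, (#|` W| < #|` U|)%N &
    forall t : V, ((t + x \in W)%R + (t + y \in W)%R = (t \in U) + (t \in I))%N].
Proof.
move=> xy W0.
pose Wx := [fset w - x | w in W]%fset.
pose Wy := [fset w - y | w in W]%fset.
have cx : #|` Wx| = #|` W| by rewrite card_imfset//; exact: addIr.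
have cy : #|` Wy| = #|` W| by rewrite card_imfset//; exact: addIr.
have mx t : (t \in Wx) = (t + x \in W).
  apply/imfsetP/idP => [[w /= wW ->]|tW]; first by rewrite subrK.
  by exists (t + x) => //; rewrite addrK.
have my t : (t \in Wy) = (t + y \in W).
  apply/imfsetP/idP => [[w /= wW ->]|tW]; first by rewrite subrK.
  by exists (t + y) => //; rewrite addrK.
have Wxy : Wx != Wy. (* their elements have different sums *)
  apply/eqP => E.
  have : (\sum_(w <- Wx) w)%R = (\sum_(w <- Wy) w)%R by rewrite E.
  rewrite !big_imfset /=; [|by move=> ? ? _ _; exact: addIr..].
  rewrite !big_split /= => /addrI.
  rewrite !big_const_seq !iter_addr !addr0 !count_predT => /eqP.
  rewrite -subr_eq0 -mulrnBl -scaler_nat scaler_eq0 pnatr_eq0 cardfs_eq0 (negbTE W0)/=.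
  by rewrite opprK addrC subr_eq0 => /eqP/esym/eqP; exact/negP.
exists (Wx `|` Wy)%fset, (Wx `&` Wy)%fset; split.
- by rewrite cardfsUI cx cy mul2n addnn.
- rewrite -cx; apply: fproper_ltn_card; rewrite fproperEneq fsubsetUl andbT.
  apply: contra Wxy; rewrite eq_sym => /eqP/fsetUidPl yx.
  by rewrite eq_sym eqEfcard yx cx cy leqnn.
by move=> t; rewrite inE [in RHS]inE mx my; case: (t + x \in W); case: (t + y \in W).
Qed.

Let hits n (W : {fset V}) := avg (R := R) a b n (fun s => (\sum_(x <- s) x \in W)%R%:R).

Let hits_le1 n W : hits n W <= 1.
Proof. by rewrite -(avg_cst a b n 1) le_avg// => s _; case: (_ \in W). Qed.

(* When [a n <> b n], conditioning on the last choice replaces a set of size [r]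
   by two sets of sizes [r + j] and [r - j] with [1 <= j]. The affine part of
   [bound] is preserved by averaging over these, and the concave quadratic part
   decreases by the factor [1 - L^-2]. *)
Let bound (L M r : nat) : R :=
  r%:R / L%:R + (1 - L%:R ^- 2) ^+ M * (r * (2 * L - r))%:R.

(** Finite sets instead of points make the induction on [n] close, since conditioning on a choice
    turns one set into two others. From size [L] on, the bound is at least 1 and nothing is to be
    proved; below [L], the sizes [r + j] and [r - j] stay within [2 * L]. *)
Lemma concentration (L n : nat) (W : {fset V}) : (1 < L)%N -> (#|` W| <= 2 * L)%N ->
  hits n W <= bound L (\sum_(k < n) (a k != b k)) #|` W|.
Proof.
move=> L1; have L0 : 0 < L%:R :> R by rewrite ltr0n; lia.
have L2 : L%:R ^- 2 <= 1 :> R.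
  by rewrite invf_le1 ?exprn_gt0// -natrX ler1n expn_gt0; lia.
have lam0 : 0 <= 1 - L%:R ^- 2 :> R by rewrite subr_ge0.
have key r M : (L <= r)%N -> 1 <= bound L M r.
  move=> Lr; rewrite /bound -[leLHS]addr0; apply: lerD.
    by rewrite ler_pdivlMr// mul1r ler_nat.
  by rewrite mulr_ge0// exprn_ge0.
elim: n W => [|n IHn] W W2L.
  rewrite big_ord0 /hits avg0 big_nil /bound expr0 mul1r.
  have [W0|W0] := eqVneq W fset0%fset.
    by rewrite W0 inE cardfs0 mul0r mul0n addr0.
  have := W0; rewrite -cardfs_gt0 => Wgt0.
  case: (ltnP #|`W| (2 * L)) => h; last first.
    apply: (@le_trans _ _ 1); first by case: (_ \in W).
    have := key #|` W| 0; rewrite /bound expr0 mul1r; apply; lia.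
  apply: (@le_trans _ _ 1); first by case: (_ \in W).
  rewrite -[leLHS]add0r; apply: lerD; first by rewrite divr_ge0.
  by rewrite ler1n muln_gt0 Wgt0 subn_gt0.
rewrite big_ord_recr /=.
have [E|neq] /= := eqVneq (a n) (b n).
  rewrite addn0 /hits avgS E.
  rewrite [X in X <= _](_ : _ = hits n [fset w - b n | w in W]%fset); last first.
    set A := avg _ _ _ _; rewrite (_ : 2^-1 * (A + A) = A); last by lra.
    apply: eq_avg => s _; congr (_%:R); congr nat_of_bool.
    rewrite big_rcons /=; apply/idP/imfsetP => [tW|[w /= wW ->]].
      by exists (\sum_(x <- s) x + b n) => //; rewrite addrK.
    by rewrite subrK.
  have c : #|` [fset w - b n | w in W]%fset| = #|` W|.
    by rewrite card_imfset//; exact: addIr.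
  by rewrite -c; apply: IHn; rewrite c.
rewrite addn1.
have [W0|W0] := eqVneq W fset0%fset.
  rewrite W0 /bound cardfs0 mul0r mul0n mulr0 addr0.
  by rewrite /hits; under eq_avg do rewrite inE; rewrite avg_cst.
case: (leqP L #|` W|) => WL; first exact: le_trans (hits_le1 _ _) (key _ _ WL).
have [U [I [cUI cU UI]]] := translate_fset neq W0.
have -> : hits n.+1 W = 2^-1 * (hits n U + hits n I).
  rewrite /hits avgS -!avgD; congr (_ * _); apply: eq_avg => s _.
  by rewrite !big_rcons /= -!natrD UI.
have U2 : (#|` U| <= 2 * L)%N by lia.
have I2 : (#|` I| <= 2 * L)%N by lia.
apply: (@le_trans _ _ (2^-1 * (bound L (\sum_(k < n) (a k != b k)) #|` U| +
                               bound L (\sum_(k < n) (a k != b k)) #|` I|))).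
  by apply: ler_wpM2l => //; apply: lerD; exact: IHn.
rewrite /bound [X in _ <= _ + X * _]exprS; set lam := (1 - _) ^+ _.
have lam_ge0 : 0 <= lam by rewrite exprn_ge0.
set r := #|` W| in cUI cU WL *.
have [j [j1 Uj Ij jr]] : exists j, [/\ (1 <= j)%N, #|` U| = (r + j)%N,
    #|` I| = (r - j)%N & (j <= r)%N].
  by exists (#|` U| - r)%N; split; lia.
rewrite Uj Ij !natrM !natrB ?natrM; [|lia..].
rewrite natrD; set rr := r%:R; set jj := j%:R; set LL := L%:R.
have jj1 : 1 <= jj by rewrite ler1n.
have jr' : jj <= rr by rewrite ler_nat.
have rL : rr <= LL by rewrite ler_nat ltnW.
have LL0 : 0 < LL by [].
have -> : (1 - LL ^- 2) * lam * (rr * (2 * LL - rr)) =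
   lam * (rr * (2 * LL - rr)) - lam * (rr * (2 * LL - rr) / LL ^+ 2) by ring.
have -> : 2^-1 * ((rr + jj) / LL + lam * ((rr + jj) * (2 * LL - (rr + jj))) +
    ((rr - jj) / LL + lam * ((rr - jj) * (2 * LL - (rr - jj))))) =
  rr / LL + (lam * (rr * (2 * LL - rr)) - lam * jj ^+ 2) by field; rewrite gt_eqF.
rewrite lerD2l lerD2l lerN2 ler_wpM2l//.
(* [r (2 L - r) <= L ^ 2] because the difference is [(L - r) ^ 2]; hence the loss [j ^ 2 >= 1] is at
   least the fraction [L ^- 2] of the quadratic term. *)
apply: (@le_trans _ _ 1); last by rewrite expr_ge1// (le_trans _ jj1).
rewrite ler_pdivrMr ?exprn_gt0// mul1r -subr_ge0.
by have := sqr_ge0 (LL - rr); congr (_ <= _); ring.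
Qed.

Hypothesis inf_neq : infinite_set [set k | a k != b k].

Lemma count_infinite M : exists K, (M <= \sum_(k < K) (a k != b k))%N.
Proof.
elim: M => [|M [K HK]]; first by exists 0%N.
have [k [Kk /= neq]] : exists k, (K <= k)%N /\ a k != b k.
  apply/not_existsP => H; apply: inf_neq.
  apply: (@sub_finite_set _ _ `I_K); last exact: finite_II.
  by move=> k /= neq; rewrite ltnNge; apply/negP => Kk; apply: (H k).
exists k.+1; rewrite big_ord_recr /= neq addn1 ltnS.
apply: leq_trans HK _.
rewrite -(big_mkord xpredT (fun k => nat_of_bool (a k != b k))).
rewrite -(big_mkord xpredT (fun k => nat_of_bool (a k != b k))).
by rewrite (big_cat_nat (leq0n _) Kk)//= leq_addr.
Qed.

(** For a singleton the bound is [1 / L] plus [2 L - 1] times a power of [1 - L ^- 2]: [L] is fixed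
    first, then enough indices with [a k != b k] are collected to make the power small. *)
Lemma atoms_vanish (e : R) : 0 < e ->
  exists K, forall v : V, avg a b K (fun s => (\sum_(x <- s) x == v)%R%:R) <= e.
Proof.
move=> e0.
have [L [L1 Le]] : exists L : nat, (1 < L)%N /\ L%:R^-1 <= e / 2.
  exists (Num.truncn (2 / e)).+2; split=> //.
  rewrite invf_ple ?posrE ?divr_gt0// invf_div.
  have := truncnS_gt (2 / e); rewrite -[(Num.truncn (2 / e)).+2%:R]natr1; lra.
have L0 : 0 < L%:R :> R by rewrite ltr0n; lia.
have lam1 : `|1 - L%:R ^- 2| < 1 :> R.
  rewrite ltr_norml; have : L%:R ^- 2 < 1 :> R.
    by rewrite invf_lt1 ?exprn_gt0// -natrX ltr1n -(expn0 L) ltn_exp2l.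
  have : 0 < L%:R ^- 2 :> R by rewrite invr_gt0 exprn_gt0.
  lra.
have /cvgrPdist_lt/(_ (e / 2 / (2 * L)%:R)) := cvg_expr lam1.
have e2 : 0 < e / 2 / (2 * L)%:R by rewrite !divr_gt0// ltr0n; lia.
move=> /(_ e2) [M _ /(_ M (leqnn M))]; rewrite /= sub0r normrN => lamM.
have [K HK] := count_infinite M.
exists K => v.
have := @concentration L K [fset v]%fset L1; rewrite cardfs1 => /(_ _).
rewrite /hits; under eq_avg do rewrite inE; move=> H.
apply: le_trans (H _) _; first by lia.
rewrite /bound mul1r mul1n [leRHS](splitr e); apply: lerD => //.
apply: (@le_trans _ _ (`|(1 - L%:R ^- 2) ^+ M| * (2 * L)%:R)).
  apply: ler_pM => //.
  - rewrite exprn_ge0// subr_ge0 invf_le1 ?exprn_gt0// -natrX ler1n expn_gt0; lia.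
  - rewrite normrX ger0_norm; last first.
      by rewrite subr_ge0 invf_le1 ?exprn_gt0// -natrX ler1n expn_gt0; lia.
    apply: ler_wiXn2l => //.
      by rewrite subr_ge0 invf_le1 ?exprn_gt0// -natrX ler1n expn_gt0; lia.
  - by rewrite ler_nat leq_subr.
by rewrite -ler_pdivlMr ?ltW// ltr0n; lia.
Qed.

Lemma separated (vs : seq V) : exists2 e : R, 0 < e &
  forall u v, u \in vs -> v \in vs -> `|u - v| < e -> u = v.
Proof.
have [e e0 He] : exists2 e : R, 0 < e &
    forall x, x \in [seq `|u - v| | u <- vs, v <- vs] -> x < e -> x <= 0.
  elim: [seq _ | _ <- _, _ <- _] => [|x r [e e0 He]]; first by exists 1.
  exists (if 0 < x then Num.min x e else e); first by case: ifP => //; rewrite lt_min => ->.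
  move=> y; rewrite inE => /orP[/eqP ->|yr].
    by case: (ltP 0 x) => // _; rewrite lt_min ltxx.
  by case: ifP => _; [rewrite lt_min => /andP[_]|]; exact: He.
exists e => // u v uvs vvs uve; apply/eqP; rewrite -subr_eq0 -normr_le0.
by apply: He uve; exact: allpairs_f.
Qed.

(** After [K] steps the sum has finitely many values, and a ball of radius half their least
    separation meets at most one of them, so its weight is at most that of an atom. Later steps only
    average over translated centres, hence the uniformity in [n] and [v]. *)
Lemma anti_concentration (e : R) : 0 < e -> exists (delta : R) (K : nat),
  [/\ 0 < delta & forall n (v : V), (K <= n)%N ->
    avg a b n (fun s => (`|\sum_(x <- s) x - v| < delta)%R%:R) <= e].
Proof.
move=> /atoms_vanish[K HK].
have [d d0 Hd] := separated [seq \sum_(x <- s) x | s <- choices a b K].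
exists (d / 2), K; split; first by rewrite divr_gt0.
elim=> [|n IHn] v.
  rewrite leqn0 => /eqP K0; move: HK Hd; rewrite K0 => HK _; rewrite avg0 big_nil.
  by apply: le_trans (HK 0); rewrite avg0 big_nil eqxx; case: (_ < _).
rewrite leq_eqVlt => /orP[/eqP KE|]; last first.
  rewrite ltnS => /IHn IH; rewrite avgS.
  under eq_avg do rewrite big_rcons /= -addrA -opprB.
  under [X in _ + X]eq_avg do rewrite big_rcons /= -addrA -opprB.
  by have := IH (v - a n); have := IH (v - b n); lra.
rewrite -KE.
have [/hasP[s sK sv]|/hasPn none] :=
    boolP (has (fun s => `|\sum_(x <- s) x - v| < d / 2) (choices a b K)).
  apply: le_trans (HK (\sum_(x <- s) x)); apply: le_avg => t tK.
  case: ltP => // tv; rewrite (Hd (\sum_(x <- t) x) (\sum_(x <- s) x)) ?eqxx//.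
  - exact: map_f.
  - exact: map_f.
  rewrite (splitr d) (le_lt_trans (ler_distD v _ _))// ltrD//.
  by rewrite distrC.
apply: le_trans (HK 0); apply: le_avg => t /none /negbTE -> /=.
exact: ler0n.
Qed.

End littlewood_offord.

Lemma avg_map {R : realType} {T U : eqType} (g : T -> U) (a b : nat -> T) n (G : seq U -> R) :
  avg (g \o a) (g \o b) n G = avg a b n (fun s => G (map g s)).
Proof.
elim: n G => [|n IHn] G; first by rewrite !avg0.
by rewrite !avgS !IHn; congr (_ * (_ + _)); apply: eq_avg => s _; rewrite map_rcons.
Qed.

(** * The plane as a product *)

Section plane.
Context {R : realType}.
Local Notation C := (Rcomplex R).
Local Notation leb := (@lebesgue_measure R).
Local Notation leb2 := (leb \x leb)%E.

Lemma normcE (z : C) : `|z| = Num.sqrt (complex.Re z ^+ 2 + complex.Im z ^+ 2).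
Proof. by case: z. Qed.

Lemma normcM (z w : C) : `|(z * w : C)| = `|z| * `|w|.
Proof. exact: Normc.normcM. Qed.

Lemma ler_Re_normc (z : C) : `|complex.Re z| <= `|z|.
Proof. by rewrite normcE -sqrtr_sqr ler_wsqrtr// lerDl sqr_ge0. Qed.

Lemma ler_Im_normc (z : C) : `|complex.Im z| <= `|z|.
Proof. by rewrite normcE -sqrtr_sqr ler_wsqrtr// lerDr sqr_ge0. Qed.

Lemma normc_le (x y : R) : `|(Complex x y : C)| <= `|x| + `|y|.
Proof.
rewrite normcE /= -[leRHS]ger0_norm ?addr_ge0// -sqrtr_sqr ler_wsqrtr//.
rewrite sqrrD !real_normK ?num_real//.
have := mulr_ge0 (normr_ge0 x) (normr_ge0 y); lra.
Qed.

Definition plane (z : R * R) : C := Complex z.1 z.2.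

Lemma continuous_plane : continuous plane.
Proof.
move=> z; apply/cvgrPdist_lt => e e0.
near=> w.
have -> : plane z - plane w = Complex (z.1 - w.1) (z.2 - w.2) by [].
apply: le_lt_trans (normc_le _ _) _.
rewrite (splitr e); apply: ltrD; near: w.
- have : fst @ z --> z.1 by exact: cvg_fst.
  by move/cvgrPdist_lt; apply; rewrite divr_gt0.
- have : snd @ z --> z.2 by exact: cvg_snd.
  by move/cvgrPdist_lt; apply; rewrite divr_gt0.
Unshelve. all: by end_near. Qed.

Lemma continuous_planel (y : R) : continuous (fun x => plane (x, y)).
Proof.
move=> x; apply/cvgrPdist_lt => e e0; near=> t.
have -> : plane (x, y) - plane (t, y) = Complex (x - t) (y - y) by [].
apply: le_lt_trans (normc_le _ _) _; rewrite subrr normr0 addr0.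
by near: t; exact: (@cvgr_dist_lt _ _ _ (nbhs x) _ id x).
Unshelve. all: by end_near. Qed.

Lemma continuous_planer (x : R) : continuous (fun y => plane (x, y)).
Proof.
move=> y; apply/cvgrPdist_lt => e e0; near=> t.
have -> : plane (x, y) - plane (x, t) = Complex (x - x) (y - t) by [].
apply: le_lt_trans (normc_le _ _) _; rewrite subrr normr0 add0r.
by near: t; exact: (@cvgr_dist_lt _ _ _ (nbhs y) _ id y).
Unshelve. all: by end_near. Qed.

(** An open set is the union of the rational boxes inside it; this relates the product
    sigma-algebra, on which the product Lebesgue measure lives, to the topology. *)
Lemma open_measurable2 (A : set (R * R)) : open A -> measurable A.
Proof.
move=> oA.
pose box (i : rat * rat * rat) : set (R * R) :=
  `]ratr i.1.1 - ratr i.2, ratr i.1.1 + ratr i.2[%classic `*`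
  `]ratr i.1.2 - ratr i.2, ratr i.1.2 + ratr i.2[%classic.
have -> : A = \bigcup_(i in [set i | box i `<=` A]) box i.
  apply/seteqP; split => [z Az|z [i /= iA]]; last exact: iA.
  have : nbhs z A by exact: open_nbhs_nbhs.
  move=> /nbhs_ballP[e /= e0 eA].
  have e2 : 0 < e / 2 by rewrite divr_gt0.
  have [r /andP[/[!bnd_simp] r0 re]] := rat_in_itvoo e2.
  have [p /andP[/[!bnd_simp] p1 p2]] : exists p : rat, ratr p \in `](z.1 - ratr r), z.1[.
    by apply: rat_in_itvoo; rewrite gtrBl.
  have [q /andP[/[!bnd_simp] q1 q2]] : exists q : rat, ratr q \in `](z.2 - ratr r), z.2[.
    by apply: rat_in_itvoo; rewrite gtrBl.
  exists (p, q, r); last first.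
    by split; rewrite /= in_itv /=; apply/andP; split; lra.
  move=> w [/= w1 w2]; apply: eA.
  rewrite !in_itv /= in w1 w2; case/andP: w1 => w1 w1'; case/andP: w2 => w2 w2'.
  by split => /=; rewrite /ball/= ltr_norml; apply/andP; split; lra.
rewrite bigcup_mkcond; apply: countable_bigcupT_measurable => // i.
case: ifP => // _; apply: measurableX; exact: measurable_itv.
Qed.

Lemma continuous_measurable_fun2 (g : R * R -> R) :
  continuous g -> measurable_fun setT g.
Proof.
move=> /continuousP cg; apply: (measurability _ (RGenOpens.measurableE R)).
move=> _ [_ [a [b ->] <-]]; rewrite setTI; apply: open_measurable2.
exact/cg/interval_open.
Qed.

Lemma measurable_plane (f : C -> R) :
  continuous f -> measurable_fun setT (f \o plane).
Proof.
move=> cf; apply: continuous_measurable_fun2 => z.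
apply: continuous_comp; first exact: continuous_plane.
exact: cf.
Qed.

Lemma measurable_sqrt : measurable_fun setT (@Num.sqrt R).
Proof.
apply: continuous_measurable_fun; exact: sqrt_continuous.
Qed.

Lemma normc_planeB (c : C) (z : R * R) :
  `|plane z - c| = Num.sqrt ((z.1 - complex.Re c) ^+ 2 + (z.2 - complex.Im c) ^+ 2).
Proof. by rewrite normcE; case: c. Qed.

Lemma measurable_sqB (c : C) : measurable_fun setT
  (fun z : R * R => (z.1 - complex.Re c) ^+ 2 + (z.2 - complex.Im c) ^+ 2).
Proof.
by apply: measurable_funD; apply: measurable_funX; apply: measurable_funB.
Qed.

Lemma measurable_normcB (c : C) : measurable_fun setT (fun z : R * R => `|plane z - c|).
Proof.
under eq_fun do rewrite normc_planeB.
apply: measurableT_comp; first exact: measurable_sqrt.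
exact: measurable_sqB.
Qed.

Lemma ge0_integral_translate (p : R) (g : R -> \bar R) :
  measurable_fun setT g -> (forall x, (0 <= g x)%E) ->
  (\int[leb]_x g (x - p)%R = \int[leb]_x g x)%E.
Proof.
move=> mg g0.
pose phi (x : measurableTypeR R) : measurableTypeR R := x - p.
have mphi : measurable_fun setT phi by exact: measurable_funB.
transitivity (\int[pushforward leb phi]_x g x)%E.
  by rewrite ge0_integral_pushforward// preimage_setT.
pose m := measure_function_pushforward__canonical__measure_function_Measure
  leb mphi.
rewrite -[LHS]/(\int[m]_x g x)%E; apply: eq_measure_integral => /= A mA _.
apply/esym.
rewrite -[RHS]/(m A); apply: lebesgue_measure_unique => // X [[i j]] /= ij <-.
rewrite /m /= /pushforward.
rewrite [X in _ = leb X](_ : _ = `](i + p), (j + p)]%classic); last first.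
  by apply/seteqP; split => x /=; rewrite !in_itv /= ltrBrDr lerBlDr.
by rewrite !lebesgue_measure_itv /= !lte_fin ltrD2r -!EFinB opprD addrACA subrr addr0.
Qed.

Lemma ge0_integral_translate2 (c : C) (g : R * R -> \bar R) :
  measurable_fun setT g -> (forall z, (0 <= g z)%E) ->
  (\int[leb2]_z g (z.1 - complex.Re c, z.2 - complex.Im c)%R = \int[leb2]_z g z)%E.
Proof.
move=> mg g0.
have m1 (d : R) : measurable_fun setT (fun x : R => x - d) by exact: measurable_funB.
have mt : measurable_fun setT
    (fun z : R * R => (z.1 - complex.Re c, z.2 - complex.Im c)%R).
  by apply: measurable_fun_pair; exact: measurable_funB.
rewrite fubini_tonelli1; [|exact: (measurableT_comp mg mt)|by []].
rewrite fubini_tonelli1; [|by []..].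
rewrite /fubini_F.
transitivity (\int[leb]_x (\int[leb]_y g ((x - complex.Re c)%R, y)))%E.
  apply: eq_integral => x _.
  apply: (ge0_integral_translate (complex.Im c)
    (g := fun y => g ((x - complex.Re c)%R, y))) => //.
  by apply: measurableT_comp => //; exact: measurable_fun_pair.
apply: (ge0_integral_translate (complex.Re c) (g := fun x => \int[leb]_y g (x, y))%E) => //.
- exact: measurable_fun_fubini_tonelli_F.
- by move=> x; apply: integral_ge0.
Qed.

Lemma ge0_integral_prod (g h : R -> R) :
  measurable_fun setT g -> measurable_fun setT h ->
  (forall x, 0 <= g x) -> (forall x, 0 <= h x) ->
  (\int[leb2]_z (g z.1 * h z.2)%:E = \int[leb]_x (g x)%:E * \int[leb]_x (h x)%:E)%E.
Proof.
move=> mg mh g0 h0.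
rewrite fubini_tonelli1//; last 2 first.
- apply/measurable_EFinP; apply: measurable_funM.
    exact: measurableT_comp mg measurable_fst.
  exact: measurableT_comp mh measurable_snd.
- by move=> z; rewrite lee_fin mulr_ge0.
rewrite /fubini_F /=.
transitivity (\int[leb]_x ((g x)%:E * \int[leb]_x (h x)%:E))%E.
  apply: eq_integral => x _; under eq_integral do rewrite EFinM.
  rewrite ge0_integralZl_EFin//.
  - by move=> ? _; rewrite lee_fin.
  - exact/measurable_EFinP.
rewrite ge0_integralZr//.
- exact/measurable_EFinP.
- by move=> ? _; rewrite lee_fin.
- by apply: integral_ge0 => ? _; rewrite lee_fin.
Qed.

End plane.

(** * Green's formula for the regularized logarithm *)

Section green.
Context {R : realType}.
Local Notation C := (Rcomplex R).
Local Notation leb := (@lebesgue_measure R).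
Local Notation leb2 := (leb \x leb)%E.

Lemma is_derive_continuous (f df : R -> R) :
  (forall x : R, is_derive x 1 f (df x)) -> continuous f.
Proof.
move=> fdf x; apply: differentiable_continuous; apply/derivable1_diffP.
exact: (@ex_derive _ _ _ _ _ _ _ (fdf x)).
Qed.

Lemma continuousX {T : topologicalType} (f : T -> R) (x : T) n :
  {for x, continuous f} -> {for x, continuous (fun y => f y ^+ n)}.
Proof. by move=> cf; apply: (@continuous_comp _ _ _ f (fun y => y ^+ n)) => //; exact: exprn_continuous. Qed.

(** The integrand is the derivative of [df * u - f * du], which vanishes at both ends of
    [[- r, r]]. *)
Lemma integral_by_parts2 (r : R) (f df ddf u du ddu : R -> R) : 0 < r ->
  (forall x : R, is_derive x 1 f (df x)) -> (forall x : R, is_derive x 1 df (ddf x)) ->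
  (forall x : R, is_derive x 1 u (du x)) -> (forall x : R, is_derive x 1 du (ddu x)) ->
  continuous ddf -> continuous ddu ->
  (forall x, r <= `|x| -> [/\ f x = 0, df x = 0 & ddf x = 0]) ->
  (\int[leb]_x (ddf x * u x - f x * ddu x)%:E = 0)%E.
Proof.
move=> r0 Df Ddf Du Ddu cddf cddu f0.
have cf := is_derive_continuous Df; have cdf := is_derive_continuous Ddf.
have cu := is_derive_continuous Du; have cdu := is_derive_continuous Ddu.
have rr : - r < r by lra.
transitivity (\int[leb]_(x in `[(- r)%R, r%R]) (ddf x * u x - f x * ddu x)%:E)%E.
  rewrite [RHS]integral_mkcond; apply: eq_integral => x _.
  rewrite patchE; case: ifPn => //; rewrite notin_setE /= in_itv /= => /negP xr.
  have /f0[-> _ ->] : r <= `|x|.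
    by rewrite leNgt; apply: contra xr; rewrite ltr_norml => /andP[/ltW -> /ltW ->].
  by rewrite !mul0r subrr.
have DG (x : R) : is_derive x 1 (df * u - f * du)%R (ddf x * u x - f x * ddu x).
  apply: is_derive_eq; rewrite /GRing.scale /=; ring.
rewrite (@continuous_FTC2 _ _ (df * u - f * du)%R)//.
- rewrite /= !fctE.
  have [-> -> _] : [/\ f r = 0, df r = 0 & ddf r = 0] by apply: f0; rewrite ger0_norm// ltW.
  have [-> -> _] : [/\ f (- r) = 0, df (- r) = 0 & ddf (- r) = 0].
    by apply: f0; rewrite normrN ger0_norm// ltW.
  by rewrite !mul0r subrr subee.
- apply: continuous_subspaceT => x; apply: cvgB; apply: cvgM => //;
  [exact: cddf|exact: cu|exact: cf|exact: cddu].
- have cG := is_derive_continuous DG.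
  split => //.
  + by apply: cvg_at_right_filter; exact: cG.
  + by apply: cvg_at_left_filter; exact: cG.
- by move=> x _; rewrite derive1E; exact: derive_val.
Qed.

Definition logpot1 (p B x : R) := 2^-1 * ln ((x - p) ^+ 2 + B).

Lemma is_derive_logpot1 (p B x : R) : 0 < B ->
  is_derive x 1 (logpot1 p B) ((x - p) / ((x - p) ^+ 2 + B)).
Proof.
move=> B0; have h : 0 < (x - p) ^+ 2 + B by rewrite ltr_wpDl// sqr_ge0.
have D1 : is_derive x 1 (fun x : R => (x - p) ^+ 2 + B) (2 * (x - p)).
  by apply: is_derive_eq; rewrite /GRing.scale /=; ring.
have D2 : is_derive x 1 (fun x : R => ln ((x - p) ^+ 2 + B))
    (((x - p) ^+ 2 + B)^-1 * (2 * (x - p))).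
  apply: (@is_derive1_comp _ (@ln R) (fun x : R => (x - p) ^+ 2 + B)).
  exact: is_derive1_ln.
by apply: is_derive_eq; rewrite /GRing.scale /=; field; rewrite gt_eqF.
Qed.

Lemma is_derive_dlogpot1 (p B x : R) : 0 < B ->
  is_derive x 1 (fun x : R => (x - p) / ((x - p) ^+ 2 + B))
    ((B - (x - p) ^+ 2) / ((x - p) ^+ 2 + B) ^+ 2).
Proof.
move=> B0; have h : 0 < (x - p) ^+ 2 + B by rewrite ltr_wpDl// sqr_ge0.
have D1 : is_derive x 1 (fun x : R => (x - p) ^+ 2 + B) (2 * (x - p)).
  by apply: is_derive_eq; rewrite /GRing.scale /=; ring.
have D2 : is_derive x 1 (fun x : R => ((x - p) ^+ 2 + B)^-1)
    (- (2 * (x - p)) / ((x - p) ^+ 2 + B) ^+ 2).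
  have hne : (x - p) ^+ 2 + B != 0 by rewrite gt_eqF.
  have := @is_deriveV _ (fun x : R => (x - p) ^+ 2 + B) x _ 1 hne D1; rewrite /GRing.scale /= => DV.
  by apply: is_derive_eq; field.
by apply: is_derive_eq; rewrite /GRing.scale /=; field; rewrite gt_eqF.
Qed.

Lemma continuous_ddlogpot1 (p B : R) : 0 < B ->
  continuous (fun x : R => (B - (x - p) ^+ 2) / ((x - p) ^+ 2 + B) ^+ 2).
Proof.
move=> B0 x; have h : 0 < (x - p) ^+ 2 + B by rewrite ltr_wpDl// sqr_ge0.
have cX : {for x, continuous (fun x : R => (x - p) ^+ 2)}.
  by apply: (@continuousX _ (fun x : R => x - p)); apply: cvgB; [exact: cvg_id|exact: cvg_cst].
apply: cvgM; first by apply: cvgB => //; exact: cvg_cst.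
apply: cvgV; first by rewrite expf_neq0// gt_eqF.
by apply: (@continuousX _ (fun x : R => (x - p) ^+ 2 + B)); apply: cvgD => //; exact: cvg_cst.
Qed.

Definition sqd (c : C) (z : R * R) : R :=
  (z.1 - complex.Re c) ^+ 2 + (z.2 - complex.Im c) ^+ 2.

(** A smooth majorant of [ln |z - c|] for [e > 0], whose Laplacian is an approximate point mass at
    [c]; Green's formula then needs no excision around [c]. *)
Definition logpot (e : R) (c : C) (z : R * R) : R := 2^-1 * ln (sqd c z + e).

(* Laplacian of [logpot e c]. *)
Definition mollifier (e : R) (c : C) (z : R * R) : R := 2 * e / (sqd c z + e) ^+ 2.

Lemma sqd_ge0 c z : 0 <= sqd c z.
Proof. by rewrite addr_ge0 ?sqr_ge0. Qed.

Lemma measurable_sqd c : measurable_fun setT (sqd c).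
Proof. exact: measurable_sqB. Qed.

Lemma measurable_logpot e c : measurable_fun setT (logpot e c).
Proof.
apply: measurable_funM => //; apply: measurableT_comp => //.
by apply: measurable_funD => //; exact: measurable_sqd.
Qed.

Lemma mollifier_ge0 e c z : 0 < e -> 0 <= mollifier e c z.
Proof.
by move=> e0; rewrite divr_ge0 ?sqr_ge0// mulr_ge0// ltW.
Qed.

Lemma measurable_mollifier e c : 0 < e -> measurable_fun setT (mollifier e c).
Proof.
move=> e0.
(* The absolute value removes the pole of the outer function at [- e], so that it is continuous on
   the whole line. *)
have -> : mollifier e c = (fun t : R => 2 * e / (`|t| + e) ^+ 2) \o sqd c.
  by apply/funext => z; rewrite /= ger0_norm// sqd_ge0.
apply: measurableT_comp; last exact: measurable_sqd.
apply: continuous_measurable_fun => x.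
apply: cvgM; first exact: cvg_cst.
apply: cvgV; first by rewrite expf_neq0// gt_eqF// ltr_wpDl.
apply: (@continuousX _ (fun x : R => `|x| + e)); apply: cvgD; last exact: cvg_cst.
exact: norm_continuous.
Qed.

End green.

(** * Test functions and Green's formula in the plane *)

Section test_function_calculus.
Context {R : realType}.
Local Notation C := (Rcomplex R).
Local Notation leb := (@lebesgue_measure R).
Local Notation leb2 := (leb \x leb)%E.
Implicit Types (f g : C -> R) (K : set C).

Lemma is_derive_line f (v : C) (l : R -> C) :
  (forall h x : R, l (h + x) = h *: v + l x) -> (forall z, derivable f z v) ->
  forall x : R, is_derive x 1 (fun t => f (l t)) ('D_v f (l x)).
Proof.
move=> lv Df x.
have E : (fun h : R => h^-1 *: (((fun t => f (l t)) \o shift x) (h *: 1) - f (l x))) =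
    (fun h : R => h^-1 *: ((f \o shift (l x)) (h *: v) - f (l x))).
  by apply/funext => h /=; rewrite [h *: 1]mulr1 lv.
by split; [rewrite /derivable E; exact: Df|rewrite /derive E].
Qed.

Lemma derive_outside f K (v : C) : closed K ->
  (forall z, ~ K z -> f z = 0) -> forall z, ~ K z -> 'D_v f z = 0.
Proof.
move=> cK f0 z Kz.
rewrite (@near_eq_derive _ _ _ f (cst 0) z v); first exact: derive_cst.
have : nbhs z (~` K) by apply: open_nbhs_nbhs; split => //; exact: closed_openC.
by apply: filterS => w /f0.
Qed.

Lemma bounded_outside f K : compact K -> continuous f ->
  (forall z, ~ K z -> f z = 0) -> exists M : R, forall z, `|f z| <= M.
Proof.
move=> cK cf f0.
have cfK : compact (f @` K).
  by apply: continuous_compact => //; exact: continuous_subspaceT.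
have [M [_ HM]] := @compact_bounded R R^o _ cfK.
exists (`|M| + 1) => z.
have [Kz|/f0 ->] := pselect (K z); last by rewrite normr0 addr_ge0.
apply: (HM (`|M| + 1)); last by exists z.
by rewrite (le_lt_trans (ler_norm M))// ltrDl.
Qed.

(** What Green's formula and mollification use of a test function: derivatives along coordinate
    lines, one radius outside which all vanish, one bound. Bounding [fxx] and [fyy] jointly makes
    [M] a bound for the Laplacian; the bounds on [fx] and [fy] give the Lipschitz estimate. *)
Record smooth_bump f fx fxx fy fyy (r M : R) : Prop := Bump {
  bump_r : 0 < r;
  bump_f : continuous f;
  bump_cxx : continuous fxx;
  bump_cyy : continuous fyy;
  bump_dx : forall x y : R, is_derive x 1 (fun t => f (plane (t, y))) (fx (plane (x, y)));
  bump_dxx : forall x y : R, is_derive x 1 (fun t => fx (plane (t, y))) (fxx (plane (x, y)));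
  bump_dy : forall x y : R, is_derive y 1 (fun t => f (plane (x, t))) (fy (plane (x, y)));
  bump_dyy : forall x y : R, is_derive y 1 (fun t => fy (plane (x, t))) (fyy (plane (x, y)));
  bump_out : forall z, r <= `|z| -> [/\ f z = 0, fx z = 0, fxx z = 0, fy z = 0 & fyy z = 0];
  bump_le : forall z, [/\ `|f z| <= M, `|fx z| <= M, `|fy z| <= M &
    `|fxx z| + `|fyy z| <= M] }.

Lemma test_function_bump f : test_function f ->
  exists fx fxx fy fyy r M, smooth_bump f fx fxx fy fyy r M.
Proof.
move=> [/(_ 3%N) [cf Df1 Df2 [cfx Dfx1 _ [cfxx _ _ _ _] _] [cfy _ Dfy2 _ [cfyy _ _ _ _]]] cK].
set K := closure _ in cK.
have clK : closed K by exact: closed_closure.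
have f0 z : ~ K z -> f z = 0.
  move=> Kz; apply/eqP; apply: contrapT => /negP fz; apply: Kz.
  exact: subset_closure.
have fx0 := derive_outside (Complex 1 0) clK f0.
have fxx0 := derive_outside (Complex 1 0) clK fx0.
have fy0 := derive_outside (Complex 0 1) clK f0.
have fyy0 := derive_outside (Complex 0 1) clK fy0.
have [M1 H1] := bounded_outside cK cf f0.
have [M2 H2] := bounded_outside cK cfx fx0.
have [M3 H3] := bounded_outside cK cfy fy0.
have [M4 H4] := bounded_outside cK cfxx fxx0.
have [M5 H5] := bounded_outside cK cfyy fyy0.
have [r [_ Hr]] := @compact_bounded R C _ cK.
pose M := `|M1| + `|M2| + `|M3| + `|M4| + `|M5|.
have lineX (y h x : R) : plane (h + x, y) = h *: (Complex 1 0 : C) + plane (x, y).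
  by rewrite /plane /= /GRing.add /GRing.scale /= mulr1 mulr0 add0r.
have lineY (x h y : R) : plane (x, h + y) = h *: (Complex 0 1 : C) + plane (x, y).
  by rewrite /plane /= /GRing.add /GRing.scale /= mulr1 mulr0 add0r.
exists ('D_(Complex 1 0 : C) f), ('D_(Complex 1 0 : C) ('D_(Complex 1 0 : C) f)).
exists ('D_(Complex 0 1 : C) f), ('D_(Complex 0 1 : C) ('D_(Complex 0 1 : C) f)).
(* The bound of the support holds at levels above [r], such as [|r| + 1]; one more unit makes the
   exclusion of the support strict. *)
exists (`|r| + 2), M; split.
- by rewrite ltr_wpDl.
- exact: cf.
- exact: cfxx.
- exact: cfyy.
- by move=> x y; exact: (is_derive_line (lineX y) Df1).
- by move=> x y; exact: (is_derive_line (lineX y) Dfx1).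
- by move=> x y; exact: (is_derive_line (lineY x) Df2).
- by move=> x y; exact: (is_derive_line (lineY x) Dfy2).
- move=> z rz.
  have Kz : ~ K z.
    have rr : r < `|r| + 1 by rewrite (le_lt_trans (ler_norm r))// ltrDl.
    by move=> /(Hr _ rr) /= h; have := le_trans rz h; lra.
  by split; [exact: f0|exact: fx0|exact: fxx0|exact: fy0|exact: fyy0].
move=> z.
have aux (a b c d e : R) : 0 <= a -> 0 <= b -> 0 <= c -> 0 <= d -> 0 <= e ->
    [/\ a <= a + b + c + d + e, b <= a + b + c + d + e, c <= a + b + c + d + e &
        d + e <= a + b + c + d + e] by move=> *; split; lra.
have [h1 h2 h3 h4] := aux _ _ _ _ _ (normr_ge0 M1) (normr_ge0 M2) (normr_ge0 M3)
  (normr_ge0 M4) (normr_ge0 M5).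
split.
- exact: le_trans (le_trans (H1 z) (ler_norm _)) h1.
- exact: le_trans (le_trans (H2 z) (ler_norm _)) h2.
- exact: le_trans (le_trans (H3 z) (ler_norm _)) h3.
apply: le_trans h4; apply: lerD.
- exact: le_trans (H4 z) (ler_norm _).
- exact: le_trans (H5 z) (ler_norm _).
Qed.

Lemma lipschitz1 (g dg : R -> R) (M : R) :
  (forall x : R, is_derive x 1 g (dg x)) -> (forall x, `|dg x| <= M) ->
  forall x y, `|g x - g y| <= M * `|x - y|.
Proof.
move=> Dg dgM.
suff H x y : x < y -> `|g x - g y| <= M * `|x - y|.
  move=> x y; have [xy|xy|->] := ltgtP x y; first exact: H.
    by rewrite distrC (distrC x); exact: H.
  by rewrite !subrr !normr0 mulr0.
move=> xy; have [|c _] := @MVT R g dg x y xy (fun z _ => Dg z).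
  by apply: continuous_subspaceT; exact: is_derive_continuous Dg.
rewrite distrC => ->; rewrite normrM (distrC x).
by rewrite ler_wpM2r.
Qed.

Section smooth_bump.
Context {f fx fxx fy fyy : C -> R} {r M : R} (B : smooth_bump f fx fxx fy fyy r M).

Lemma bump_lipschitz (z : R * R) (c : C) :
  `|f (plane z) - f c| <= M * (`|z.1 - complex.Re c| + `|z.2 - complex.Im c|).
Proof.
case: z c => x y [p q] /=.
have h1 := lipschitz1 (fun x => bump_dx B x y)
  (fun x => let: And4 _ h _ _ := bump_le B (plane (x, y)) in h) x p.
have h2 := lipschitz1 (fun y => bump_dy B p y)
  (fun y => let: And4 _ _ h _ := bump_le B (plane (p, y)) in h) y q.
have := ler_distD (f (plane (p, y))) (f (plane (x, y))) (f (plane (p, q))).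
rewrite mulrDr; rewrite /= in h1 h2; rewrite -[Complex p q]/(plane (p, q)); lra.
Qed.

Definition box (s : R) : set (R * R) := `[- s, s]%classic `*` `[- s, s]%classic.

Lemma measurable_box (s : R) : measurable (box s).
Proof. by apply: measurableX; exact: measurable_itv. Qed.

Lemma lebesgue_measure_symitv (s : R) : 0 <= s -> leb `[- s, s]%classic = (2 * s)%:E.
Proof.
move=> s0; rewrite lebesgue_measure_itv /= lte_fin; case: ltP => h.
  by rewrite -EFinB; congr (_%:E); ring.
by rewrite (_ : s = 0) ?mulr0//; lra.
Qed.

Lemma box_measure (s : R) : 0 <= s -> leb2 (box s) = ((2 * s) ^+ 2)%:E.
Proof.
move=> s0; rewrite product_measure1E; [|exact: measurable_itv..].
by rewrite expr2 EFinM; congr (_ * _)%E; exact: lebesgue_measure_symitv.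
Qed.

Lemma integral_box (s : R) : 0 <= s ->
  (\int[leb2]_z (\1_(box s) z)%:E = ((2 * s) ^+ 2)%:E)%E.
Proof.
move=> s0; rewrite integral_indic//; last exact: measurable_box.
by rewrite setIT; exact: box_measure.
Qed.

Lemma notin_box (s : R) (z : R * R) : 0 <= s -> ~ box s z -> s <= `|plane z|.
Proof.
move=> s0 /not_andP[h|h].
  apply: le_trans (ler_Re_normc _); rewrite leNgt; apply/negP => h'; apply: h.
  by rewrite /= in_itv /=; move: h'; rewrite ltr_norml => /andP[/ltW -> /ltW ->].
apply: le_trans (ler_Im_normc _); rewrite leNgt; apply/negP => h'; apply: h.
by rewrite /= in_itv /=; move: h'; rewrite ltr_norml => /andP[/ltW -> /ltW ->].
Qed.

Lemma integrable_box (s N : R) (h : R * R -> R) : 0 <= s -> measurable_fun setT h ->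
  (forall z, box s z -> `|h z| <= N) -> (forall z, ~ box s z -> h z = 0) ->
  leb2.-integrable setT (EFin \o h).
Proof.
move=> s0 mh hN h0.
have ib : leb2.-integrable setT (fun z => N%:E * (\1_(box s) z)%:E)%E.
  apply: integrableZl => //; apply/integrableP; split.
    apply/measurable_EFinP; exact: measurable_indic (measurable_box s).
  under eq_integral do rewrite gee0_abs ?lee_fin//.
  by rewrite integral_box// ltry.
apply: le_integrable ib => //; first exact/measurable_EFinP.
move=> z _ /=; rewrite lee_fin indicE.
have [Bz|Bz] := pselect (box s z).
  by rewrite mem_set// mulr1; apply: le_trans (hN _ Bz) (ler_norm _).
by rewrite h0// normr0.
Qed.

Lemma logpot_bound (s e : R) (c : C) : 0 < e -> exists N : R, forall z, box s z -> `|logpot e c z| <= N.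
Proof.
move=> e0.
pose S := (`|s| + `|complex.Re c|) ^+ 2 + (`|s| + `|complex.Im c|) ^+ 2 + e.
exists (`|ln e| + `|ln S|) => -[x y] [/=]; rewrite !in_itv /= => /andP[x1 x2] /andP[y1 y2].
have sq (u p : R) : - s <= u -> u <= s -> (u - p) ^+ 2 <= (`|s| + `|p|) ^+ 2.
  move=> h1 h2; rewrite -real_normK ?num_real// lerXn2r ?nnegrE ?addr_ge0//.
  rewrite (le_trans (ler_normB _ _))// lerD2r ler_norml.
  by have := ler_norm s; lra.
have h1 : e <= sqd c (x, y) + e by rewrite lerDr sqd_ge0.
have h2 : sqd c (x, y) + e <= S by rewrite lerD2r; apply: lerD; exact: sq.
have h0 : 0 < sqd c (x, y) + e by exact: lt_le_trans h1.
have l1 : ln e <= ln (sqd c (x, y) + e) by rewrite ler_ln ?posrE.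
have l2 : ln (sqd c (x, y) + e) <= ln S by rewrite ler_ln ?posrE// (lt_le_trans h0).
have := ler_norm (ln S); have := ler_norm (- ln e); rewrite normrN.
have := normr_ge0 (ln S); have := normr_ge0 (ln e).
rewrite /logpot ler_norml; lra.
Qed.

Lemma bump_plane0 (z : R * R) : r <= `|z.1| \/ r <= `|z.2| ->
  [/\ f (plane z) = 0, fx (plane z) = 0, fxx (plane z) = 0, fy (plane z) = 0 &
      fyy (plane z) = 0].
Proof.
by case=> h; apply: bump_out B _ _; apply: le_trans h _;
  [exact: (ler_Re_normc (plane z))|exact: (ler_Im_normc (plane z))].
Qed.

Lemma bump_box (z : R * R) : ~ box r z ->
  [/\ f (plane z) = 0, fx (plane z) = 0, fxx (plane z) = 0, fy (plane z) = 0 &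
      fyy (plane z) = 0].
Proof. by move=> h; apply: bump_out B _ _; apply: notin_box h; rewrite ltW// (bump_r B). Qed.

End smooth_bump.

(** [pxx] and [pyy] are the second partial derivatives of [logpot e c], the last factor being
    [(sqd c z + e) ^- 2]. They add up to [mollifier e c z]. *)
Let pxx (e : R) (c : C) (z : R * R) := ((z.2 - complex.Im c) ^+ 2 + e - (z.1 - complex.Re c) ^+ 2) *
  ((2 * e)^-1 * mollifier e c z).
Let pyy (e : R) (c : C) (z : R * R) := ((z.1 - complex.Re c) ^+ 2 + e - (z.2 - complex.Im c) ^+ 2) *
  ((2 * e)^-1 * mollifier e c z).

Let mpxx (e : R) (c : C) : 0 < e -> measurable_fun setT (pxx e c).
Proof.
move=> e0; apply: measurable_funM.
  apply: measurable_funB; last by apply: measurable_funX; apply: measurable_funB.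
  by apply: measurable_funD => //; apply: measurable_funX; apply: measurable_funB.
by apply: measurable_funM => //; exact: measurable_mollifier.
Qed.

Let mpyy (e : R) (c : C) : 0 < e -> measurable_fun setT (pyy e c).
Proof.
move=> e0; apply: measurable_funM.
  apply: measurable_funB; last by apply: measurable_funX; apply: measurable_funB.
  by apply: measurable_funD => //; apply: measurable_funX; apply: measurable_funB.
by apply: measurable_funM => //; exact: measurable_mollifier.
Qed.

Let ple (e A D : R) : 0 < e -> 0 <= A -> 0 <= D ->
  `|(D + e - A) * ((2 * e)^-1 * (2 * e / (A + D + e) ^+ 2))| <= e^-1.
Proof.
move=> e0 A0 D0.
have h : 0 < A + D + e by lra.
rewrite (_ : _ * _ = (D + e - A) / (A + D + e) ^+ 2); last by field; rewrite !gt_eqF.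
rewrite normrM normfV [X in _ / X]ger0_norm ?sqr_ge0// ler_pdivrMr ?exprn_gt0//.
apply: (@le_trans _ _ (A + D + e)); first by rewrite ler_norml; lra.
by rewrite mulrC ler_pdivlMr// expr2 ler_pM2l//; lra.
Qed.

Let pxx_le (e : R) (c : C) (z : R * R) : 0 < e -> `|pxx e c z| <= e^-1.
Proof. by move=> e0; apply: ple => //; rewrite sqr_ge0. Qed.

Let pyy_le (e : R) (c : C) (z : R * R) : 0 < e -> `|pyy e c z| <= e^-1.
Proof.
move=> e0; rewrite /pyy /mollifier /sqd (addrC ((z.1 - _) ^+ 2) ((z.2 - _) ^+ 2)).
by apply: ple => //; rewrite sqr_ge0.
Qed.

Lemma mollifier_le (e : R) (c : C) (z : R * R) : 0 < e -> mollifier e c z <= 2 / e.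
Proof.
move=> e0; rewrite ler_pdivrMr; last by rewrite exprn_gt0// ltr_wpDl// sqd_ge0.
rewrite mulrAC ler_pdivlMr// -mulrA ler_pM2l// -expr2.
have h : e <= sqd c z + e by rewrite lerDr sqd_ge0.
by rewrite lerXn2r// ?nnegrE ltW// (lt_le_trans e0 h).
Qed.

Lemma integrable_compact_mul (r N : R) (g : C -> R) (h : R * R -> R) : 0 <= r ->
  continuous g ->
  (forall z, `|g z| <= N) -> (forall z, r <= `|z| -> g z = 0) ->
  measurable_fun setT h -> (exists N' : R, forall z, box r z -> `|h z| <= N') ->
  leb2.-integrable setT (fun z => (g (plane z) * h z)%:E).
Proof.
move=> r0 cg gN g0 mh [N' hN'].
apply: (@integrable_box r (N * `|N'|)) => //.
- by apply: measurable_funM => //; exact: measurable_plane.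
- move=> z /hN' h'; rewrite normrM ler_pM// (le_trans h')// ler_norm//.
- by move=> z Bz; rewrite g0 ?mul0r//; exact: notin_box.
Qed.

(** Integration by parts on each horizontal line trades [fxx] for the second derivative [pxx] of the
    logarithm, and on each vertical line [fyy] for [pyy]. Fubini, valid since everything is bounded
    and lives on a box, assembles the lines. *)
Lemma green f fx fxx fy fyy (r M : R) (B : smooth_bump f fx fxx fy fyy r M) (e : R) (c : C) :
  0 < e ->
  (\int[leb2]_z ((fxx (plane z) + fyy (plane z)) * logpot e c z)%:E =
   \int[leb2]_z (f (plane z) * mollifier e c z)%:E)%E.
Proof.
move=> e0.
pose I1 (z : R * R) := fxx (plane z) * logpot e c z - f (plane z) * pxx e c z.
pose I2 (z : R * R) := fyy (plane z) * logpot e c z - f (plane z) * pyy e c z.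
have r0 := bump_r B.
have mf := measurable_plane (bump_f B).
have mfxx := measurable_plane (bump_cxx B).
have mfyy := measurable_plane (bump_cyy B).
have fM z : `|f z| <= M by case: (bump_le B z).
have fxM z : `|fxx z| <= M.
  by case: (bump_le B z) => _ _ _; apply: le_trans; rewrite lerDl.
have fyM z : `|fyy z| <= M.
  by case: (bump_le B z) => _ _ _; apply: le_trans; rewrite lerDr.
have out z (rz : r <= `|z|) := bump_out B rz.
have ib g (h : R * R -> R) := @integrable_compact_mul r M g h (ltW r0).
have iA : leb2.-integrable setT (fun z => (fxx (plane z) * logpot e c z)%:E).
  apply: ib => //; [exact: bump_cxx B|by move=> z /out[]|exact: measurable_logpot|].
  exact: logpot_bound.
have iA' : leb2.-integrable setT (fun z => (fyy (plane z) * logpot e c z)%:E).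
  apply: ib => //; [exact: bump_cyy B|by move=> z /out[]|exact: measurable_logpot|].
  exact: logpot_bound.
have ip : leb2.-integrable setT (fun z => (f (plane z) * pxx e c z)%:E).
  apply: ib => //; [exact: bump_f B|by move=> z /out[]|exact: mpxx|].
  by exists e^-1 => z _; exact: pxx_le.
have ip' : leb2.-integrable setT (fun z => (f (plane z) * pyy e c z)%:E).
  apply: ib => //; [exact: bump_f B|by move=> z /out[]|exact: mpyy|].
  by exists e^-1 => z _; exact: pyy_le.
have iK : leb2.-integrable setT (fun z => (f (plane z) * mollifier e c z)%:E).
  apply: ib => //; [exact: bump_f B|by move=> z /out[]|exact: measurable_mollifier|].
  by exists (2 / e) => z _; rewrite ger0_norm ?mollifier_ge0// mollifier_le.
have i1 : leb2.-integrable setT (EFin \o I1).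
  apply: eq_integrable (integrableB _ iA ip) => // z _ /=; by rewrite -EFinB.
have i2 : leb2.-integrable setT (EFin \o I2).
  apply: eq_integrable (integrableB _ iA' ip') => // z _ /=; by rewrite -EFinB.
have B0 (t : R) : 0 < t ^+ 2 + e by rewrite ltr_wpDl// sqr_ge0.
have z1 : (\int[leb2]_z (I1 z)%:E = 0)%E.
  rewrite -(integral21_prod_meas1 i1) integral0_eq// => y _; rewrite /fubini_G.
  have := @integral_by_parts2 _ r _ _ _ _ _ _ r0
    (bump_dx B ^~ y) (bump_dxx B ^~ y)
    (fun x => is_derive_logpot1 (complex.Re c) x (B0 (y - complex.Im c)))
    (fun x => is_derive_dlogpot1 (complex.Re c) x (B0 (y - complex.Im c))).
  move=> <-.
  - apply: eq_integral => x _ /=; congr (_%:E); rewrite /I1; congr (_ * _ - _ * _).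
      by rewrite /logpot /sqd /= -addrA.
    rewrite /pxx /mollifier /sqd /= -addrA.
    by field; rewrite !gt_eqF//= ltr_wpDl ?sqr_ge0.
  - move=> x; apply: (@continuous_comp _ _ _ (fun t => plane (t, y)) fxx).
      exact: continuous_planel.
    exact: bump_cxx B _.
  - exact: continuous_ddlogpot1.
  by move=> x rx; case: (bump_plane0 B (or_introl rx : r <= `|(x, y).1| \/ r <= `|(x, y).2|)).
have z2 : (\int[leb2]_z (I2 z)%:E = 0)%E.
  rewrite -(integral12_prod_meas1 i2) integral0_eq// => x _; rewrite /fubini_F.
  have := @integral_by_parts2 _ r _ _ _ _ _ _ r0
    (bump_dy B x) (bump_dyy B x)
    (fun y => is_derive_logpot1 (complex.Im c) y (B0 (x - complex.Re c)))
    (fun y => is_derive_dlogpot1 (complex.Im c) y (B0 (x - complex.Re c))).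
  move=> <-.
  - apply: eq_integral => y _ /=; congr (_%:E); rewrite /I2; congr (_ * _ - _ * _).
      by rewrite /logpot /sqd /= (addrC ((x - _) ^+ 2)) -addrA.
    rewrite /pyy /mollifier /sqd /= (addrC ((x - _) ^+ 2) ((y - _) ^+ 2)) -addrA.
    by field; rewrite !gt_eqF//= ltr_wpDl ?sqr_ge0.
  - move=> y; apply: (@continuous_comp _ _ _ (fun t => plane (x, t)) fyy).
      exact: continuous_planer.
    exact: bump_cyy B _.
  - exact: continuous_ddlogpot1.
  by move=> y ry; case: (bump_plane0 B (or_intror ry : r <= `|(x, y).1| \/ r <= `|(x, y).2|)).
transitivity (\int[leb2]_z ((f (plane z) * mollifier e c z)%:E + (I1 z)%:E + (I2 z)%:E))%E.
  apply: eq_integral => z _; rewrite -!EFinD; congr (_%:E).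
  have -> : mollifier e c z = pxx e c z + pyy e c z.
    rewrite /pxx /pyy /mollifier /sqd; field.
    by rewrite !gt_eqF//= ltr_wpDl ?addr_ge0 ?sqr_ge0.
  by rewrite /I1 /I2; ring.
rewrite integralD//; last by apply: integrableD.
by rewrite integralD// z1 z2 !adde0.
Qed.

End test_function_calculus.

(** * Laplacians of regularized logarithms as an approximate identity *)

Section mollification.
Context {R : realType}.
Local Notation C := (Rcomplex R).
Local Notation leb := (@lebesgue_measure R).
Local Notation leb2 := (leb \x leb)%E.

Let w (t : R) : R := (1 + t ^+ 2)^-1.

Let w_gt0 t : 0 < w t.
Proof. by rewrite invr_gt0 ltr_pwDl// sqr_ge0. Qed.

Let continuous_w : continuous w.
Proof. exact: continuous_oneDsqrV. Qed.

Let mw : measurable_fun setT w.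
Proof. exact: continuous_measurable_fun. Qed.

Let integral_w : (\int[leb]_x (w x)%:E = pi%:E)%E.
Proof.
rewrite ge0_symfun_integralT; last 3 first.
- by move=> x; exact/ltW/w_gt0.
- exact: continuous_w.
- by move=> x; rewrite /w /= sqrrN.
have -> : [set x : R | 0 <= x] = `[0, +oo[%classic.
  by apply/seteqP; split => x /=; rewrite in_itv /= andbT.
rewrite integral0y_oneDsqr -EFinM; congr (_%:E).
by rewrite mulrC divfK.
Qed.

(** A product of Cauchy kernels dominates the radial [mollifier] up to constants, both for
    finiteness and in the tail, so that one-dimensional integrals replace polar coordinates. *)
Let w2 (c : C) (z : R * R) : R := w (z.1 - complex.Re c) * w (z.2 - complex.Im c).

Let mw2 c : measurable_fun setT (w2 c).
Proof.
by apply: measurable_funM; apply: (measurableT_comp mw); apply: measurable_funB.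
Qed.

Let w2_ge0 c z : 0 <= w2 c z.
Proof. by apply: mulr_ge0; exact/ltW/w_gt0. Qed.

Let integral_w2 c : (\int[leb2]_z (w2 c z)%:E = (pi ^+ 2)%:E)%E.
Proof.
have := @ge0_integral_translate2 R c (fun z => (w z.1 * w z.2)%:E).
rewrite /= => ->; last 2 first.
- apply/measurable_EFinP; apply: measurable_funM.
    exact: measurableT_comp mw measurable_fst.
  exact: measurableT_comp mw measurable_snd.
- by move=> z; rewrite lee_fin mulr_ge0// ltW// w_gt0.
rewrite ge0_integral_prod//; [|by move=> x; exact/ltW/w_gt0..].
by rewrite integral_w.
Qed.

(** Polar coordinates would give [2 * pi]; the mass is kept as a symbol, with the lower bound
    [mass_ge]. *)
Definition mass (e : R) : R := fine (\int[leb2]_z (mollifier e (0 : C) z)%:E)%E.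

Let mollifier_translate e (c : C) (z : R * R) :
  mollifier e c z = mollifier e 0 (z.1 - complex.Re c, z.2 - complex.Im c).
Proof. by rewrite /mollifier /sqd /= !subr0. Qed.

Lemma integral_mollifier (e : R) (c : C) : 0 < e -> e <= 1 ->
  (\int[leb2]_z (mollifier e c z)%:E = (mass e)%:E)%E.
Proof.
move=> e0 e1.
have mm := measurable_mollifier (0 : C) e0.
under eq_integral do rewrite mollifier_translate.
rewrite (@ge0_integral_translate2 R c (EFin \o mollifier e 0)).
- rewrite fineK// ge0_fin_numE; last first.
    by apply: integral_ge0 => z _; rewrite lee_fin mollifier_ge0.
  apply: (@le_lt_trans _ _ (\int[leb2]_z ((2 / e) * w2 0 z)%:E)%E).
    apply: ge0_le_integral => //.
    - by move=> z _; rewrite lee_fin mollifier_ge0.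
    - exact/measurable_EFinP.
    - by apply/measurable_EFinP; apply: measurable_funM => //; exact: mw2.
    move=> z _; rewrite lee_fin /mollifier /w2 /w /sqd !subr0 -invfM.
    have h1 : 0 < 1 + z.1 ^+ 2 by rewrite ltr_pwDl// sqr_ge0.
    have h2 : 0 < 1 + z.2 ^+ 2 by rewrite ltr_pwDl// sqr_ge0.
    have s1 := sqr_ge0 z.1; have s2 := sqr_ge0 z.2.
    set S := _ + _ + e.
    (* This is where [e <= 1] enters. Both factors are at most [S], so their product is at most
       [S ^ 2]. *)
    have u1 : e * (1 + z.1 ^+ 2) <= S by rewrite /S; nra.
    have u2 : e * (1 + z.2 ^+ 2) <= S by rewrite /S; nra.
    have S0 : 0 < S by rewrite (lt_le_trans _ u1)// mulr_gt0.
    have -> : 2 / e / ((1 + z.1 ^+ 2) * (1 + z.2 ^+ 2)) =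
        2 * e / (e * (1 + z.1 ^+ 2) * (e * (1 + z.2 ^+ 2))).
      by field; rewrite !gt_eqF.
    rewrite ler_pM2l ?mulr_gt0// lef_pV2 ?posrE ?exprn_gt0 ?mulr_gt0//.
    by rewrite expr2 ler_pM// mulr_ge0// ltW.
  under eq_integral do rewrite EFinM.
  rewrite ge0_integralZl_EFin//.
  - by rewrite integral_w2 -EFinM ltry.
  - by move=> z _; rewrite lee_fin w2_ge0.
  - by apply/measurable_EFinP; exact: mw2.
  - by rewrite divr_ge0// ltW.
- exact/measurable_EFinP.
- by move=> z; rewrite lee_fin mollifier_ge0.
Qed.

(** On the square of half-side [sqrt e] the mollifier is at least [2 e / (3 e) ^ 2], and the area is
    [4 e]. *)
Lemma mass_ge (e : R) : 0 < e -> e <= 1 -> 8 / 9 <= mass e.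
Proof.
move=> e0 e1; rewrite -lee_fin -(integral_mollifier 0)//.
have se0 : 0 <= Num.sqrt e by rewrite sqrtr_ge0.
have -> : (8 / 9)%:E = (\int[leb2]_z ((2 / (9 * e))%:E * (\1_(box (Num.sqrt e)) z)%:E))%E.
  rewrite ge0_integralZl_EFin//.
  - rewrite integral_box// -EFinM; congr (_%:E).
    by rewrite exprMn sqr_sqrtr ?ltW//; field; rewrite gt_eqF.
  - by apply/measurable_EFinP; exact: measurable_indic (measurable_box _).
  - by rewrite divr_ge0// mulr_ge0// ltW.
apply: ge0_le_integral => //.
- by move=> z _; rewrite mule_ge0// lee_fin divr_ge0// mulr_ge0// ltW.
- apply: measurable_funeM; apply/measurable_EFinP.
  exact: measurable_indic (measurable_box _).
- by apply/measurable_EFinP; exact: measurable_mollifier.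
move=> z _; rewrite -EFinM lee_fin indicE.
have [Bz|Bz] := pselect (box (Num.sqrt e) z); last first.
  by rewrite memNset// mulr0 mollifier_ge0.
rewrite mem_set// mulr1.
have sq t : t \in `[- Num.sqrt e, Num.sqrt e] -> t ^+ 2 <= e.
  rewrite in_itv /= => ht; rewrite -(sqr_sqrtr (ltW e0)).
  by rewrite -real_normK ?num_real// lerXn2r ?nnegrE// ler_norml.
case: Bz => /sq h1 /sq h2.
rewrite /mollifier /sqd !subr0.
have h : 0 < z.1 ^+ 2 + z.2 ^+ 2 + e by rewrite ltr_wpDl// addr_ge0 ?sqr_ge0.
rewrite ler_pdivrMr ?mulr_gt0// mulrAC ler_pdivlMr ?exprn_gt0//.
apply: (@le_trans _ _ (2 * (3 * e) ^+ 2)).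
  by rewrite ler_pM2l// lerXn2r// ?nnegrE; lra.
by rewrite le_eqVlt; apply/orP; left; apply/eqP; ring.
Qed.

(** Within [rho] of the centre in both coordinates the Lipschitz bound applies; outside, the
    mollifier is [O(e)] times an integrable function. The threshold [e0] must not depend on [c],
    since the centres will include critical points of unknown position. *)
Lemma mollifier_approx (f fx fxx fy fyy : C -> R) (r M : R)
    (B : smooth_bump f fx fxx fy fyy r M) (delta : R) : 0 < delta ->
  exists e0 : R, [/\ 0 < e0, e0 <= 1 & forall e c, 0 < e -> e <= e0 ->
    exists I : R, (\int[leb2]_z (f (plane z) * mollifier e c z)%:E = I%:E)%E /\
      `|mass e * f c - I| <= delta * mass e].
Proof.
move=> d0.
have fM z : `|f z| <= M by case: (bump_le B z).
have M0 : 0 <= M by exact: le_trans (fM 0).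
pose rho := Num.min 1 (delta / (4 * (M + 1))).
have rho0 : 0 < rho by rewrite lt_min ltr01 divr_gt0// mulr_gt0// ltr_wpDl.
have rho1 : rho <= 1 by rewrite ge_min lexx.
have Mrho : 2 * M * rho <= delta / 2.
  apply: (@le_trans _ _ (2 * (M + 1) * (delta / (4 * (M + 1))))).
    apply: ler_pM => //; rewrite ?mulr_ge0 ?(ltW rho0)//; first by lra.
    by rewrite ge_min lexx orbT.
  by rewrite le_eqVlt; apply/orP; left; apply/eqP; field; lra.
(* [A * e] bounds the far contribution, [16 M e / rho ^ 4] times the mass [pi ^ 2] of [w2]; [M + 1]
   keeps [A] positive. The resulting [delta / 4] fits into half of [delta * mass e] because
   [mass e >= 8 / 9]. *)
pose A := 16 * (M + 1) * pi ^+ 2 / rho ^+ 4 : R.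
have A0 : 0 < A by rewrite divr_gt0 ?exprn_gt0// !mulr_gt0 ?exprn_gt0 ?pi_gt0// ltr_wpDl.
exists (Num.min 1 (delta / 4 / A)); split.
- by rewrite lt_min ltr01; apply: divr_gt0 => //; apply: divr_gt0.
- by rewrite ge_min lexx.
move=> e c e0; rewrite le_min => /andP[e1 eA].
have im := integral_mollifier c e0 e1.
have mm := measurable_mollifier c e0.
have m0 z : 0 <= mollifier e c z by rewrite mollifier_ge0.
have ie : leb2.-integrable setT (EFin \o mollifier e c).
  apply/integrableP; split; first exact/measurable_EFinP.
  by under eq_integral do rewrite gee0_abs ?lee_fin//; rewrite im ltry.
have mf := measurable_plane (bump_f B).
have iMe : leb2.-integrable setT (fun z => M%:E * (mollifier e c z)%:E)%E.
  exact: integrableZl.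
have ife : leb2.-integrable setT (fun z => (f (plane z) * mollifier e c z)%:E).
  apply: le_integrable iMe => //.
    by apply/measurable_EFinP; apply: measurable_funM.
  move=> z _; rewrite -EFinM !lee_fin !normrM ler_wpM2r//.
  exact: le_trans (fM _) (ler_norm _).
have icf : leb2.-integrable setT (fun z => (f c)%:E * (mollifier e c z)%:E)%E.
  exact: integrableZl.
exists (fine (\int[leb2]_z (f (plane z) * mollifier e c z)%:E)%E).
have fin : (\int[leb2]_z (f (plane z) * mollifier e c z)%:E)%E \is a fin_num.
  exact: integrable_fin_num.
rewrite fineK//; split=> //.
rewrite -lee_fin -abse_EFin EFinB fineK// mulrC EFinM -im.
rewrite -integralZl// -integralB//.
apply: (@le_trans _ _ (\int[leb2]_z ((2 * M * rho) * mollifier e c z +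
    (16 * M * e / rho ^+ 4) * w2 c z)%:E)%E).
  apply: le_trans (le_abse_integral _ _ _) _ => //.
    by apply: emeasurable_funB; [exact: measurable_int icf|exact: measurable_int ife].
  apply: ge0_le_integral => //.
  - by apply: measurableT_comp => //; apply: emeasurable_funB;
      [exact: measurable_int icf|exact: measurable_int ife].
  - by apply/measurable_EFinP; apply: measurable_funD; apply: measurable_funM => //;
    exact: mw2.
  move=> z _; rewrite -EFinM -EFinB lee_fin -mulrBl normrM [X in _ * X]ger0_norm//.
  have fL := bump_lipschitz B z c.
  have f2 : `|f c - f (plane z)| <= 2 * M.
    by apply: le_trans (ler_normB _ _) _; have := fM c; have := fM (plane z); lra.
  have [/andP[h1 h2]|far] :=
      boolP ((`|z.1 - complex.Re c| <= rho) && (`|z.2 - complex.Im c| <= rho)).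
    apply: (@le_trans _ _ (2 * M * rho * mollifier e c z)).
      rewrite ler_wpM2r// distrC; apply: le_trans fL _.
      by rewrite -mulrA mulrCA ler_wpM2l//; lra.
    rewrite lerDl; apply: mulr_ge0 => //.
    by apply: divr_ge0; [rewrite !mulr_ge0// ltW|rewrite exprn_ge0// ltW].
  apply: (@le_trans _ _ (16 * M * e / rho ^+ 4 * w2 c z)); last first.
    by rewrite lerDr; apply: mulr_ge0 => //; rewrite !mulr_ge0// ltW.
  apply: (@le_trans _ _ (2 * M * mollifier e c z)); first by rewrite ler_wpM2r.
  have tr : rho ^+ 2 <= sqd c z.
    rewrite negb_and -!ltNge in far.
    rewrite /sqd -(real_normK (num_real (z.1 - _))) -(real_normK (num_real (z.2 - _))).
    case/orP: far => h.
      apply: (@le_trans _ _ (`|z.1 - complex.Re c| ^+ 2)); last by rewrite lerDl sqr_ge0.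
      by rewrite lerXn2r ?nnegrE ?(ltW rho0)// ltW.
    apply: (@le_trans _ _ (`|z.2 - complex.Im c| ^+ 2)); last by rewrite lerDr sqr_ge0.
    by rewrite lerXn2r ?nnegrE ?(ltW rho0)// ltW.
  have t0 : 0 < sqd c z by rewrite (lt_le_trans _ tr)// exprn_gt0.
  have r2 : rho ^+ 2 <= 1 by rewrite expr_le1// ltW.
  have r20 : 0 < rho ^+ 2 by rewrite exprn_gt0.
  set u := 1 + (z.1 - complex.Re c) ^+ 2; set v := 1 + (z.2 - complex.Im c) ^+ 2.
  have s1 := sqr_ge0 (z.1 - complex.Re c); have s2 := sqr_ge0 (z.2 - complex.Im c).
  have u0 : 0 < u by rewrite ltr_pwDl.
  have v0 : 0 < v by rewrite ltr_pwDl.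
  (* Half of [sqd c z] covers [rho ^ 2 / 2] because the point is far, the other half covers
     [rho ^ 2 (u - 1) / 2] because [rho <= 1]. *)
  have h1 : rho ^+ 2 * u / 2 <= sqd c z by rewrite /u; rewrite /sqd in tr *; nra.
  have h2 : rho ^+ 2 * v / 2 <= sqd c z by rewrite /v; rewrite /sqd in tr *; nra.
  have -> : 16 * M * e / rho ^+ 4 * w2 c z =
      2 * M * (2 * e / (rho ^+ 2 * u / 2 * (rho ^+ 2 * v / 2))).
    by rewrite /w2 /w -/u -/v; field; rewrite !gt_eqF.
  rewrite ler_wpM2l ?mulr_ge0// /mollifier ler_pM2l ?mulr_gt0//.
  have X1 : 0 < (sqd c z + e) ^+ 2 by rewrite exprn_gt0// addr_gt0.
  have X2 : 0 < rho ^+ 2 * u / 2 * (rho ^+ 2 * v / 2).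
    by apply: mulr_gt0; apply: divr_gt0 => //; apply: mulr_gt0.
  rewrite lef_pV2 ?posrE//.
  apply: (@le_trans _ _ (sqd c z * sqd c z)).
    by rewrite ler_pM// divr_ge0// mulr_ge0// ltW.
  by rewrite expr2 ler_pM ?(ltW t0)// lerDl ltW.
have iw2 : leb2.-integrable setT (EFin \o w2 c).
  apply/integrableP; split; first by apply/measurable_EFinP; exact: mw2.
  by under eq_integral do rewrite gee0_abs ?lee_fin//; rewrite integral_w2 ltry.
under eq_integral do rewrite EFinD (EFinM _ (mollifier e c _)) (EFinM _ (w2 c _)).
rewrite integralD//; [|exact: integrableZl..].
rewrite !integralZl// im integral_w2 -!EFinM -EFinD lee_fin.
have me := mass_ge e0 e1.
apply: (@le_trans _ _ (delta / 2 * mass e + delta / 4)); last by nra.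
apply: lerD; first by rewrite ler_wpM2r// (le_trans _ me)// divr_ge0.
move: eA; rewrite ler_pdivlMr// => /(le_trans _); apply.
rewrite /A [leRHS](_ : _ = (16 * (M + 1) * e / rho ^+ 4) * pi ^+ 2); last by ring.
rewrite ler_wpM2r ?exprn_ge0 ?pi_ge0// ler_wpM2r ?invr_ge0 ?exprn_ge0 ?(ltW rho0)//.
by rewrite ler_wpM2r ?(ltW e0)//; lra.
Qed.

End mollification.

(** * Logarithmic potentials of critical points *)

Section kappa.
Context {R : realType}.
Local Notation C := (Rcomplex R).
Local Notation leb := (@lebesgue_measure R).
Local Notation leb2 := (leb \x leb)%E.

(* Step-function majorant of |t|^(-1/2), infinite at 0. *)
Definition kappa (t : R) : \bar R :=
  (\sum_(0 <= m <oo) (2 ^+ m.+1 * \1_(`[- (4 ^- m), 4 ^- m]) t)%:E)%E.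

Let term_ge0 m (t : R) : (0 <= (2 ^+ m.+1 * \1_(`[- (4 ^- m), 4 ^- m]%classic) t : R)%:E)%E.
Proof. by rewrite lee_fin mulr_ge0// exprn_ge0. Qed.

Lemma kappa_ge0 t : (0 <= kappa t)%E.
Proof. by apply: nneseries_ge0 => m _ _; exact: term_ge0. Qed.

Let kappa_ge m (t : R) : `|t| <= 4 ^- m -> ((2 ^+ m.+1)%:E <= kappa t)%E.
Proof.
move=> tm; have := @nneseries_lim_ge R
  (fun m => (2 ^+ m.+1 * \1_(`[- (4 ^- m), 4 ^- m]) t)%:E) xpredT 0 m.+1.
move=> /(_ (fun n _ _ => term_ge0 n t)); apply: le_trans.
rewrite big_nat_recr//= -[leLHS]add0e; apply: leeD.
  by apply: sume_ge0 => i _; exact: term_ge0.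
by rewrite indicE mem_set ?mulr1// /= in_itv /= -ler_norml.
Qed.

(** The infinite value makes bounds by [kappa] trivially true on the vertical lines through the
    singularities, where the inverse square root takes the default value 0. *)
Lemma kappa0 : kappa 0 = +oo%E.
Proof.
apply/eqyP => A A0.
have [m Am] : exists m : nat, A <= 2 ^+ m.+1.
  exists (Num.truncn A); apply: le_trans (ltW (truncnS_gt A)) _.
  by rewrite -natrX ler_nat ltnW// ltn_expl.
apply: (@le_trans _ _ (2 ^+ m.+1)%:E); first by rewrite lee_fin.
by apply: kappa_ge; rewrite normr0 invr_ge0 exprn_ge0.
Qed.

(** For [|t| < 1] and the least [m] with [4 ^- m.+1 < |t|], the [m]-th step is active at [t] and its
    height [2 ^ m.+1] exceeds the inverse square root. The summand 1 serves [|t| >= 1]. *)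
Lemma kappaP (t : R) : t != 0 -> ((Num.sqrt `|t|)^-1%:E <= 1 + kappa t)%E.
Proof.
move=> t0; have t0' : 0 < `|t| by rewrite normr_gt0.
have [t1|t1] := leP 1 `|t|.
  apply: (@le_trans _ _ 1%E); last by rewrite leeDl// kappa_ge0.
  by rewrite lee_fin invf_le1 ?sqrtr_gt0// -[leLHS]sqrtr1 ler_wsqrtr.
have ex : exists m : nat, 4 ^- m.+1 < `|t|.
  have [m hm] : exists m : nat, `|t|^-1 < 4 ^+ m.+1.
    exists (Num.truncn `|t|^-1); apply: lt_le_trans (truncnS_gt _) _.
    by rewrite -natrX ler_nat ltnW// ltn_expl.
  by exists m; rewrite invf_plt ?posrE// exprn_gt0.
case: (ex_minnP ex) => m hm minm.
have tm : `|t| <= 4 ^- m.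
  case: m hm minm => [|m] hm minm; first by rewrite expr0 invr1 ltW.
  by rewrite leNgt; apply/negP => /minm; rewrite ltnn.
apply: (@le_trans _ _ (kappa t)); last by rewrite leeDr.
apply: le_trans (kappa_ge tm).
rewrite lee_fin invf_ple ?posrE ?sqrtr_gt0 ?exprn_gt0//.
rewrite -[leLHS]ger0_norm ?invr_ge0 ?exprn_ge0// -sqrtr_sqr ler_wsqrtr//.
rewrite exprVn -exprM mulnC exprM; apply/ltW.
by rewrite (_ : 2 ^+ 2 = 4 :> R)//; ring.
Qed.

Lemma measurable_kappa : measurable_fun setT kappa.
Proof.
apply: ge0_emeasurable_sum => m; first by move=> *; exact: term_ge0.
move=> _; apply/measurable_EFinP; apply: measurable_funM => //.
Qed.

(** The [m]-th step contributes [2 ^ (m + 1) * 2 * 4 ^- m = 4 * 2 ^- m]. *)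
Lemma integral_kappa : (\int[leb]_x kappa x = 8%:E)%E.
Proof.
rewrite integral_nneseries//; last first.
- by move=> m; apply/measurable_EFinP; apply: measurable_funM.
rewrite (@eq_eseriesr _ _ (fun k => (8 / (2 ^ (k + 1))%:R)%:E)); last first.
  move=> m _; under eq_integral do rewrite EFinM.
  rewrite ge0_integralZl_EFin//; last first.
    by apply/measurable_EFinP; apply: measurable_indic; exact: measurable_itv.
  rewrite integral_indic// setIT [X in (_ * X)%E](_ : _ = (2 * 4 ^- m)%:E); last first.
    by apply: lebesgue_measure_symitv; rewrite invr_ge0 exprn_ge0.
  rewrite -EFinM addn1 natrX; congr (_%:E).
  rewrite (_ : 4 = 2 * 2 :> R); last by ring.
  by rewrite exprMn !exprS; field; rewrite expf_neq0.
have /cvg_lim := @cvg_geometric_eseries_half R 8 0.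
by move=> ->//; rewrite expr0 divr1.
Qed.

Lemma integral_kappa_box (r p : R) : 0 <= r ->
  (\int[leb2]_(z in box r) kappa (z.1 - p) <= (16 * r)%:E)%E.
Proof.
move=> r0; rewrite integral_mkcond.
have mk : measurable_fun setT (fun x : R => kappa (x - p)).
  by apply: (measurableT_comp measurable_kappa); exact: measurable_funB.
have mh : measurable_fun setT (fun z : R * R =>
    (kappa (z.1 - p) * (\1_(`[- r, r]%classic) z.2)%:E)%E).
  apply: emeasurable_funM; first exact: (measurableT_comp mk measurable_fst).
  apply/measurable_EFinP; apply: (measurableT_comp _ measurable_snd).
  by apply: measurable_indic; exact: measurable_itv.
apply: (@le_trans _ _ (\int[leb2]_z (kappa (z.1 - p) * (\1_(`[- r, r]%classic) z.2)%:E))%E).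
  apply: ge0_le_integral => //.
  - by move=> z _; apply: erestrict_ge0 => *; exact: kappa_ge0.
  - apply/(measurable_restrictT _ (measurable_box r)).
    apply: measurable_funTS; exact: (measurableT_comp mk measurable_fst).
  move=> z _; rewrite patchE; case: ifPn => [/set_mem[_ h2]|_].
    by rewrite indicE mem_set// mule1.
  by rewrite mule_ge0 ?kappa_ge0// lee_fin.
rewrite fubini_tonelli1//; last first.
  by move=> z; rewrite mule_ge0 ?kappa_ge0// lee_fin.
rewrite /fubini_F /=.
rewrite [X in (X <= _)%E](_ : _ = \int[leb]_x (kappa (x - p)%R * (2 * r)%:E))%E; last first.
  apply: eq_integral => x _; rewrite ge0_integralZl//=.
  - congr (_ * _)%E; rewrite integral_indic//.
    by rewrite setIT; exact: lebesgue_measure_symitv.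
  - by apply/measurable_EFinP; apply: measurable_indic; exact: measurable_itv.
  - exact: kappa_ge0.
rewrite ge0_integralZr//; last 2 first.
- by move=> x _; exact: kappa_ge0.
- by rewrite lee_fin mulr_ge0.
rewrite (@ge0_integral_translate R p kappa); [|exact: measurable_kappa|exact: kappa_ge0].
by rewrite integral_kappa -EFinM lee_fin; lra.
Qed.

(** Apply [ln y <= y] to [y = (lam / 2) |t| ^ (-1/2)]. A small [lam] is wanted because its term is
    summed over about [2 n] singularities, while [T] will meet either no factor [n] or the small
    area of the degenerate set. *)
Lemma ln_kappa (lam : R) : 0 < lam -> exists2 T : R, 0 <= T &
  forall t : R, t != 0 -> - ln `|t| <= T + lam * (Num.sqrt `|t|)^-1.
Proof.
move=> l0; exists (`|2 * ln (lam / 2)|); first by [].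
move=> t t0; have t0' : 0 < `|t| by rewrite normr_gt0.
have s0 : 0 < Num.sqrt `|t| by rewrite sqrtr_gt0.
have h : ln (lam / 2 / Num.sqrt `|t|) <= lam / 2 / Num.sqrt `|t|.
  by apply/ltW/ln_sublinear; rewrite !divr_gt0.
rewrite ln_div ?posrE ?divr_gt0// in h.
have -> : ln `|t| = 2 * ln (Num.sqrt `|t|).
  by rewrite -{1}(sqr_sqrtr (ltW t0')) lnXn// mulr_natl.
have := ler_norm (- (2 * ln (lam / 2))); rewrite normrN.
have -> : lam * (Num.sqrt `|t|)^-1 = 2 * (lam / 2 / Num.sqrt `|t|).
  by field; rewrite gt_eqF.
by move: h; set A := ln (lam / 2); lra.
Qed.

(** With [t] the difference of real parts and [q = e ^ (1/4) / |t| ^ (1/2)], the number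
    [e = t ^ 2 q ^ 4] is at most [q ^ 4] times the squared distance. Regularizing thus multiplies
    the latter by at most [(1 + q) ^ 4], and [ln (1 + q) <= q]. *)
Lemma logpot_kappa (e : R) (c : C) (z : R * R) : 0 < e -> z.1 != complex.Re c ->
  ln `|plane z - c| <= logpot e c z <=
  ln `|plane z - c| + 2 * Num.sqrt (Num.sqrt e) * (Num.sqrt `|z.1 - complex.Re c|)^-1.
Proof.
move=> e0; rewrite -subr_eq0 -normr_gt0 => t0.
set t := `|_| in t0 *; set a := Num.sqrt (Num.sqrt e); set b := Num.sqrt t.
have b0 : 0 < b by rewrite sqrtr_gt0.
have a0 : 0 <= a by rewrite sqrtr_ge0.
have a4 : a ^+ 4 = e by rewrite (exprM a 2 2) !sqr_sqrtr ?sqrtr_ge0// ltW.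
have b4 : b ^+ 4 = t ^+ 2 by rewrite (exprM b 2 2) sqr_sqrtr// ltW.
have ts : t ^+ 2 <= sqd c z by rewrite real_normK ?num_real// lerDl sqr_ge0.
have s0 : 0 < sqd c z by rewrite (lt_le_trans _ ts)// exprn_gt0.
have -> : ln `|plane z - c| = 2^-1 * ln (sqd c z).
  rewrite normc_planeB -/(sqd c z) -{2}(sqr_sqrtr (ltW s0)) lnXn ?sqrtr_gt0//.
  by rewrite -[ln _ *+ 2]mulr_natl mulKf.
have se : 0 < sqd c z + e by rewrite addr_gt0.
apply/andP; split; first by rewrite ler_pM2l// ler_ln ?posrE// lerDl ltW.
set q := a / b.
have q0 : 0 <= q by rewrite divr_ge0// ltW.
have -> : 2 * a * b^-1 = 2 * q by rewrite /q mulrA.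
have h : sqd c z + e <= sqd c z * (1 + q) ^+ 4.
  apply: (@le_trans _ _ (sqd c z * (1 + q ^+ 4))).
    rewrite mulrDr mulr1 lerD2l -[leLHS]a4.
    rewrite [leLHS](_ : _ = b ^+ 4 * q ^+ 4); last by rewrite /q; field; rewrite gt_eqF.
    by rewrite ler_wpM2r ?exprn_ge0// b4.
  rewrite ler_pM2l//; have := mulr_ge0 q0 q0; nra.
have q1 : 0 < 1 + q by rewrite ltr_pwDl.
have : ln (sqd c z + e) <= ln (sqd c z) + 4 * q.
  apply: (@le_trans _ _ (ln (sqd c z * (1 + q) ^+ 4))).
    by rewrite ler_ln ?posrE// mulr_gt0// exprn_gt0.
  rewrite lnM ?posrE ?exprn_gt0// lerD2l lnXn// -[ln _ *+ _]mulr_natl ler_pM2l//.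
  by apply: le_ln1Dx; rewrite (lt_le_trans _ q0)// ltrN10.
rewrite /logpot; lra.
Qed.

End kappa.

(** * Zeros of polynomials and empirical measures *)

Section zeros.
Context {R : realType}.
Local Notation C := (Rcomplex R).
Implicit Types (s : seq C) (z : C).

Lemma normc1 : `|1 : C| = 1.
Proof. by rewrite normcE /= expr1n expr0n addr0 sqrtr1. Qed.

Lemma normcV z : `|(z^-1 : C)| = `|z|^-1.
Proof.
have [->|z0] := eqVneq z 0; first by rewrite invr0 normr0 invr0.
have nz0 : `|z| != 0 by rewrite normr_eq0.
apply: (mulfI nz0); rewrite mulfV// -normcM mulfV// normc1//.
Qed.

Lemma normc_prod (I : Type) (r : seq I) (F : I -> C) :
  `|(\prod_(i <- r) F i : C)| = \prod_(i <- r) `|F i|.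
Proof. exact: (big_morph _ normcM normc1). Qed.

Lemma Rcomplex_natr_neq0 n : (n.+1%:R : C) != 0.
Proof.
rewrite -normr_eq0 -[n.+1%:R]/(1 *+ n.+1) normrMn.
by rewrite normc1 pnatr_eq0.
Qed.

Definition roots_poly s : {poly C} := \prod_(x <- s) ('X - x%:P).

Lemma deriv_roots_poly s z : z \notin s ->
  (roots_poly s)^`().[z] = (\sum_(x <- s) (z - x)^-1) * \prod_(x <- s) (z - x).
Proof.
rewrite /roots_poly; elim: s => [|x s IHs].
  by rewrite !big_nil derivC horner0 mul0r.
rewrite inE negb_or => /andP[zx /IHs {}IHs].
rewrite !big_cons derivM derivXsubC mul1r hornerD hornerM IHs hornerXsubC horner_prod.
under [X in X + _]eq_bigr do rewrite hornerXsubC.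
by field; rewrite subr_eq0.
Qed.

Lemma perm_zeros s : perm_eq (zeros (roots_poly s)) s.
Proof.
rewrite /zeros; case: closed_field_poly_normal => r /= E.
apply: prod_XsubC_eq; rewrite -/(roots_poly s) [RHS]E lead_coef_prod_XsubC.
by rewrite scale1r.
Qed.

(** The top coefficient of the derivative is the degree, nonzero in characteristic zero, so exactly
    one zero is lost. *)
Lemma deriv_roots_polyE s : (0 < size s)%N -> let t := zeros (roots_poly s)^`() in
  (size t).+1 = size s /\
  (roots_poly s)^`() = (size s)%:R *: \prod_(x <- t) ('X - x%:P).
Proof.
case: s => // x0 s' _; set s := x0 :: s'; set n := size s'.
have sP : size (roots_poly s) = n.+2 by rewrite size_prod_XsubC.
set Q := (roots_poly s)^`().
have cQ : Q`_n = n.+1%:R.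
  rewrite coef_deriv (_ : _`_n.+1 = 1)//.
  have := lead_coef_prod_XsubC s xpredT id.
  by rewrite /lead_coef -/(roots_poly s) sP.
have Q0 : Q`_n != 0 by rewrite cQ Rcomplex_natr_neq0.
have sQ : size Q = n.+1.
  apply/eqP; rewrite eqn_leq; apply/andP; split.
    by rewrite -ltnS -sP lt_size_deriv// -size_poly_gt0 sP.
  by rewrite ltnNge; apply/negP => h; move: Q0; rewrite nth_default ?eqxx.
have lQ : lead_coef Q = n.+1%:R by rewrite /lead_coef sQ.
rewrite /zeros; case: closed_field_poly_normal => r /= E.
rewrite lQ in E; split => //.
have : size Q = size (n.+1%:R *: \prod_(z <- r) ('X - z%:P)) by rewrite -E.
by rewrite sQ size_scale ?Rcomplex_natr_neq0// size_prod_XsubC => -[<-].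
Qed.

Lemma norm_deriv_roots_poly s z : (0 < size s)%N -> z \notin s ->
  (size s)%:R * \prod_(x <- zeros (roots_poly s)^`()) `|z - x| =
  `|\sum_(x <- s) ((z - x)^-1 : C)| * \prod_(x <- s) `|z - x|.
Proof.
move=> s0 zs; have [_ E] := deriv_roots_polyE s0.
have := deriv_roots_poly zs; rewrite {1}E hornerZ horner_prod => /(congr1 (fun y : C => `|y|)).
under eq_bigr do rewrite hornerXsubC.
rewrite !normcM !normc_prod => <-; congr (_ * _).
by case: (s) s0 => // x s' _; rewrite -[(size _)%:R]/(1 *+ (size s').+1) normrMn normc1.
Qed.

Lemma measurable_continuous_Rcomplex (f : C -> R) : continuous f -> measurable_fun setT f.
Proof.
move=> /continuousP cf; apply: (measurability _ (RGenOpens.measurableE R)).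
move=> _ [_ [a [b ->] <-]]; rewrite setTI; apply: sub_sigma_algebra.
exact/cf/interval_open.
Qed.

(** Integrals against sums and multiples of measures are computed for nonnegative functions, so [f]
    is shifted by [M] and the constant is subtracted afterwards. As [s] is nonempty, normalizing is
    a genuine scaling and not the dummy branch. *)
Lemma integral_empirical (f : C -> R) (M : R) s : (0 < size s)%N -> continuous f ->
  (forall z, `|f z| <= M) ->
  \int[empirical s]_z f z = (size s)%:R^-1 * \sum_(x <- s) f x.
Proof.
move=> s0 cf fM; have mf := measurable_continuous_Rcomplex cf.
have n0 : (size s)%:R != 0 :> R by rewrite pnatr_eq0 -lt0n.
have ni0 : 0 <= (size s)%:R^-1 :> R by rewrite invr_ge0.
pose m := msum (fun i => \d_(s`_i) : measure C R) (size s).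
have mT : m setT = (size s)%:R%:E.
  rewrite /m /msum /=; under eq_bigr do rewrite diracT.
  by rewrite sumEFin sumr_const card_ord.
have E (g : C -> \bar R) : (\int[empirical s]_z g z = \int[mscale (NngNum ni0) m]_z g z)%E.
  apply: eq_measure_integral => A mA _.
  rewrite /= /mscale /mnormalize /= -/m mT orbF eqe (negbTE n0) /=.
  by rewrite muleC.
have ge0 (g : C -> R) : measurable_fun setT g -> (forall z, 0 <= g z) ->
    (\int[empirical s]_z (g z)%:E = ((size s)%:R^-1 * \sum_(x <- s) g x)%:E)%E.
  move=> mg g0; have mgE : measurable_fun setT (EFin \o g) by exact/measurable_EFinP.
  rewrite E ge0_integral_mscale//; last by move=> z _; rewrite lee_fin.
  rewrite ge0_integral_measure_sum//; last by move=> z _; rewrite lee_fin.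
  rewrite EFinM; congr (_ * _)%E.
  rewrite (big_nth 0) big_mkord -sumEFin; apply: eq_bigr => i _.
  by rewrite integral_dirac// diracT mul1e.
have M0 : 0 <= M by exact: le_trans (fM 0).
have fM0 z : 0 <= f z + M by have := fM z; rewrite ler_norml; lra.
have ic : (empirical s).-integrable setT (fun _ : C => M%:E).
  exact: finite_measure_integrable_cst.
have if_ : (empirical s).-integrable setT (EFin \o f).
  apply: le_integrable ic => //; first exact/measurable_EFinP.
  by move=> z _ /=; rewrite lee_fin (ger0_norm M0).
have := ge0 (fun z => f z + M) (measurable_funD mf (measurable_cst M)) fM0.
under eq_integral do rewrite EFinD.
rewrite integralD//.
have -> : (\int[empirical s]_z M%:E = M%:E)%E.
  transitivity (M%:E * 1)%E; last by rewrite mule1.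
  rewrite integral_cst//; congr (_ * _)%E.
  exact: (probability_setT (empirical s)).
rewrite big_split /= mulrDr EFinD.
rewrite [X in (_ = _ + X%:E)%E -> _](_ : _ = M); last first.
  by rewrite big_const_seq count_predT iter_addr addr0 -[M *+ _]mulr_natl mulKf.
move=> /(congr1 (fun x => x - M%:E)%E).
by rewrite !addeK// => h; exact: (congr1 fine h).
Qed.

End zeros.

Section pointwise.
Context {R : realType}.
Local Notation C := (Rcomplex R).

Lemma ln_prod (I : eqType) (r : seq I) (F : I -> R) : (forall i, i \in r -> 0 < F i) ->
  0 < \prod_(i <- r) F i /\ ln (\prod_(i <- r) F i) = \sum_(i <- r) ln (F i).
Proof.
elim: r => [|i r IHr] F0; first by rewrite !big_nil ln1.
have [h1 h2] := IHr (fun j jr => F0 j (@mem_behead _ (i :: r) j jr)).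
have Fi : 0 < F i by apply: F0; rewrite mem_head.
by rewrite !big_cons mulr_gt0// lnM ?posrE// h2.
Qed.

(* The [eps] term is the lower bound of [ln |P' / P|] off the degenerate set, the
   indicator term the crude bound on it, and the last term bounds [- ln] and the
   regularization error near the zeros. *)
Lemma potential_bound (r eps lam T L e : R) (s t : seq C) (z : R * R) :
  0 <= eps -> 0 <= lam -> 0 <= T -> 0 <= r -> 0 < e ->
  (forall x : R, x != 0 -> - ln `|x| <= T + lam * (Num.sqrt `|x|)^-1) ->
  (size t).+1 = size s -> box r z ->
  (forall x, x \in s ++ t -> z.1 != complex.Re x) ->
  (size s)%:R * \prod_(x <- t) `|plane z - x| =
    `|\sum_(x <- s) ((plane z - x)^-1 : C)| * \prod_(x <- s) `|plane z - x| ->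
  \sum_(x <- s) log_plus `|x| <= L ->
  `|\sum_(x <- t) logpot e x z - \sum_(x <- s) logpot e x z| <=
  eps * (size s)%:R + ln (size s)%:R + T +
  ((size s)%:R * (T + ln (1 + 2 * r) + ln 2) + L) *
    ((size s)%:R * \prod_(x <- t) `|plane z - x| <
     expR (- (eps * (size s)%:R)) * \prod_(x <- s) `|plane z - x|)%R%:R +
  (lam + 2 * Num.sqrt (Num.sqrt e)) *
    \sum_(x <- s ++ t) (Num.sqrt `|z.1 - complex.Re x|)^-1.
Proof.
move=> eps0 lam0 T0 r0 e0 HT sts Bz zst hid HL.
set n := (size s)%:R.
pose l x := ln `|plane z - x|; pose U x := logpot e x z.
pose q (x : C) := (Num.sqrt `|z.1 - complex.Re x|)^-1.
set sig := 2 * Num.sqrt (Num.sqrt e).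
have sig0 : 0 <= sig by rewrite mulr_ge0// sqrtr_ge0.
have q0 x : 0 <= q x by rewrite invr_ge0 sqrtr_ge0.
have n1 : 1 <= n by rewrite ler1n -sts.
have n0 : 0 < n by exact: lt_le_trans n1.
have lnn : 0 <= ln n by rewrite ln_ge0.
have dz x : x \in s ++ t -> 0 < `|plane z - x|.
  move=> /zst zx; rewrite normr_gt0; apply: contra zx => /eqP h.
  by rewrite -subr_eq0; have := congr1 (@complex.Re R) h; case: (x) => a b /= ->.
have ds x : x \in s -> 0 < `|plane z - x| by move=> xs; apply: dz; rewrite mem_cat xs.
have dt x : x \in t -> 0 < `|plane z - x| by move=> xs; apply: dz; rewrite mem_cat xs orbT.
have lU x : x \in s ++ t -> l x <= U x <= l x + sig * q x.
  by move=> /zst zx; exact: logpot_kappa.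
have lT x : x \in s ++ t -> - l x <= T + lam * q x.
  move=> xst; have zx := zst _ xst; have := HT (z.1 - complex.Re x); rewrite subr_eq0 => /(_ zx).
  apply: le_trans; rewrite lerN2 ler_ln ?posrE; [|by rewrite normr_gt0 subr_eq0|exact: dz].
  by have := ler_Re_normc (plane z - x); case: (x).
have [ps lps] := ln_prod ds; have [pt lpt] := ln_prod dt.
rewrite -/n in hid.
have sum_q (r' : seq C) : 0 <= \sum_(x <- r') q x by apply: sumr_ge0.
have S0 : 0 < `|\sum_(x <- s) ((plane z - x)^-1 : C)|.
  by rewrite -(pmulr_lgt0 _ ps) -hid mulr_gt0.
have hid2 : ln n + \sum_(x <- t) l x =
    ln `|\sum_(x <- s) ((plane z - x)^-1 : C)| + \sum_(x <- s) l x.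
  by have := congr1 (@ln R) hid; rewrite !lnM ?posrE// lps lpt.
(* Each inverse is at most the exponential of [T] plus the whole singular sum, so adding [n] of them
   costs [ln n], which the leading coefficient [n] of the derivative cancels. *)
have up : \sum_(x <- t) l x - \sum_(x <- s) l x <= T + lam * \sum_(x <- s) q x.
  suff : ln `|\sum_(x <- s) ((plane z - x)^-1 : C)| <= ln n + (T + lam * \sum_(x <- s) q x).
    by move: hid2; lra.
  rewrite -[X in ln n + X]expRK -lnM ?posrE ?expR_gt0// ler_ln ?posrE ?mulr_gt0 ?expR_gt0//.
  apply: le_trans (ler_norm_sum _ _ _) _.
  rewrite [leRHS](_ : _ = \sum_(x <- s) expR (T + lam * \sum_(x <- s) q x)); last first.
    by rewrite big_const_seq count_predT iter_addr addr0 -mulr_natl.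
  rewrite big_seq [leRHS]big_seq; apply: ler_sum => x xs.
  rewrite normcV -(lnK (ds _ xs : _ \is Num.pos)) -expRN ler_expR.
  apply: (le_trans (lT x _)); first by rewrite mem_cat xs.
  by rewrite lerD2l ler_wpM2l// (big_rem x xs) /= lerDl sum_q.
set bad := (_ < _)%R.
(* On the box [|z - x| <= (1 + 2 r) (1 + |x|)], and [1 + |x|] is at most twice the maximum of 1 and
   [|x|]. When the distance is 0, the default [ln 0 = 0] obeys the bound too. *)
have logp (x : C) : l x <= ln (1 + 2 * r) + ln 2 + log_plus `|x|.
  have r1 : 0 < 1 + 2 * r by rewrite ltr_pwDl// mulr_ge0.
  have [zx|] := ltP 0 `|plane z - x|; last first.
    rewrite le_eqVlt ltNge normr_ge0 orbF /l => /eqP ->; rewrite ln0//.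
    rewrite !addr_ge0// ?ln_ge0 ?lerDl ?mulr_ge0// ?ler1n//.
    by rewrite /log_plus le_max lexx orbT.
  have zx2 : `|plane z - x| <= (1 + 2 * r) * (1 + `|x|).
    have z2r : `|plane z| <= 2 * r.
      case: (z) Bz => u v [/=]; rewrite !in_itv /= => hu hv.
      apply: le_trans (normc_le _ _) _.
      have : `|u| <= r by rewrite ler_norml.
      have : `|v| <= r by rewrite ler_norml.
      lra.
    have := ler_normB (plane z) x; have := normr_ge0 x.
    have := mulr_ge0 (mulr_ge0 (ler0n R 2) r0) (normr_ge0 x); lra.
  have x1 : 0 < 1 + `|x| by rewrite ltr_pwDl.
  apply: (@le_trans _ _ (ln ((1 + 2 * r) * (1 + `|x|)))).
    by rewrite ler_ln ?posrE// mulr_gt0.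
  rewrite lnM ?posrE// -addrA lerD2l.
  have [x1'|x1'] := leP `|x| 1.
    apply: (@le_trans _ _ (ln 2)); first by rewrite ler_ln ?posrE//; lra.
    by rewrite lerDl /log_plus le_max lexx orbT.
  have x0' : 0 < `|x| by exact: lt_trans x1'.
  apply: (@le_trans _ _ (ln (2 * `|x|))).
    by rewrite ler_ln ?posrE ?mulr_gt0//; lra.
  by rewrite lnM ?posrE// lerD2l /log_plus le_max lexx.
have sum_cst (r' : seq C) (c : R) : \sum_(x <- r') c = (size r')%:R * c.
  by rewrite big_const_seq count_predT iter_addr addr0 mulr_natl.
have tn : (size t)%:R <= n by rewrite ler_nat -sts.
(* Off the degenerate set this is the logarithm of the negated definition; on it the two sums are
   bounded separately, from above by [logp] and from below by [lT]. *)
have down : \sum_(x <- s) l x - \sum_(x <- t) l x <= eps * n + ln n +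
    (n * (T + ln (1 + 2 * r) + ln 2) + L) * bad%:R + lam * \sum_(x <- t) q x.
  have sqt := mulr_ge0 lam0 (sum_q t).
  have [b|b] := boolP bad; last first.
    rewrite mulr0 addr0.
    rewrite /bad -leNgt in b.
    have : ln (expR (- (eps * n)) * \prod_(x <- s) `|plane z - x|) <=
        ln (n * \prod_(x <- t) `|plane z - x|).
      by rewrite ler_ln ?posrE// mulr_gt0// expR_gt0.
    rewrite !lnM ?posrE ?expR_gt0// expRK lps lpt.
    by move: sqt; rewrite -/(l _); lra.
  rewrite mulr1.
  have h1 : \sum_(x <- s) l x <= n * (ln (1 + 2 * r) + ln 2) + L.
    apply: (@le_trans _ _ (\sum_(x <- s) (ln (1 + 2 * r) + ln 2 + log_plus `|x|))).
      by apply: ler_sum => x _; exact: logp.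
    by rewrite big_split /= sum_cst lerD2l.
  have h2 : - \sum_(x <- t) l x <= n * T + lam * \sum_(x <- t) q x.
    rewrite -sumrN; apply: (@le_trans _ _ (\sum_(x <- t) (T + lam * q x))).
      rewrite big_seq [leRHS]big_seq; apply: ler_sum => x xt; apply: lT.
      by rewrite mem_cat xt orbT.
    by rewrite big_split /= sum_cst -mulr_sumr lerD2r ler_wpM2r.
  have h3 : 0 <= eps * n by rewrite mulr_ge0// ltW.
  by move: h1 h2 h3 lnn; rewrite !mulrDr; lra.
have Us (r' : seq C) : {subset r' <= s ++ t} ->
    \sum_(x <- r') l x <= \sum_(x <- r') U x <= \sum_(x <- r') l x + sig * \sum_(x <- r') q x.
  move=> sub; apply/andP; split.
    by rewrite big_seq [leRHS]big_seq; apply: ler_sum => x /sub /lU /andP[].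
  rewrite mulr_sumr -big_split /= big_seq [leRHS]big_seq.
  by apply: ler_sum => x /sub /lU /andP[].
have /andP[u1 u2] : _ := Us s (fun x xs => etrans (mem_cat x s t) (introT orP (or_introl xs))).
have /andP[u3 u4] : _ := Us t (fun x xt => etrans (mem_cat x s t) (introT orP (or_intror xt))).
have bad0 : 0 <= (n * (T + ln (1 + 2 * r) + ln 2) + L) * bad%:R.
  rewrite mulr_ge0// addr_ge0//; last first.
    apply: le_trans HL; apply: sumr_ge0 => x _.
    by rewrite /log_plus le_max lexx orbT.
  by rewrite mulr_ge0 ?(ltW n0)// !addr_ge0// ln_ge0// ?lerDl ?mulr_ge0// ler1n.
have en0 : 0 <= eps * n by rewrite mulr_ge0// ltW.
suff main : `|\sum_(x <- t) U x - \sum_(x <- s) U x| <= eps * n + ln n + T +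
    (n * (T + ln (1 + 2 * r) + ln 2) + L) * bad%:R +
    (lam + sig) * (\sum_(x <- s) q x + \sum_(x <- t) q x).
  by rewrite big_cat; exact: main.
have := mulr_ge0 lam0 (sum_q s); have := mulr_ge0 lam0 (sum_q t).
have := mulr_ge0 sig0 (sum_q s); have := mulr_ge0 sig0 (sum_q t).
rewrite ler_norml.
move: up down u1 u2 u3 u4 bad0 en0 lnn T0; clear.
set A := (_ + _) * bad%:R; rewrite !mulrDl !mulrDr.
set Sq := \sum_(x <- s) q x; set Tq := \sum_(x <- t) q x.
set Sl := \sum_(x <- s) l x; set Tl := \sum_(x <- t) l x.
set SU := \sum_(x <- s) U x; set TU := \sum_(x <- t) U x.
lra.
Qed.

End pointwise.

(** * Differences of potentials integrated over a box *)

Section potential_integral.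
Context {R : realType}.
Local Notation C := (Rcomplex R).
Local Notation leb := (@lebesgue_measure R).
Local Notation leb2 := (leb \x leb)%E.

(* The points [z] where |P'(z)/P(z)| < exp (- eps n), for P of degree n with
   roots [s]; both sides are products over roots, which makes the set plainly
   measurable. *)
Definition degenerate (eps : R) (s : seq C) (z : R * R) : bool :=
  (size s)%:R * \prod_(x <- zeros (roots_poly s)^`()) `|plane z - x| <
  expR (- (eps * (size s)%:R)) * \prod_(x <- s) `|plane z - x|.

Lemma measurable_prod_normcB (s : seq C) :
  measurable_fun setT (fun z : R * R => \prod_(x <- s) `|plane z - x|).
Proof.
elim: s => [|x s IHs]; first by under eq_fun do rewrite big_nil; exact: measurable_cst.
under eq_fun do rewrite big_cons.
by apply: measurable_funM => //; exact: measurable_normcB.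
Qed.

Lemma measurable_degenerate eps s : measurable_fun setT (fun z => (degenerate eps s z)%:R : R).
Proof.
apply: (@measurableT_comp _ _ _ _ _ _ (fun b : bool => b%:R : R)); first by [].
apply: measurable_fun_ltr; apply: measurable_funM => //; exact: measurable_prod_normcB.
Qed.

Definition degenerate_area (r eps : R) (s : seq C) : \bar R :=
  (\int[leb2]_(z in box r) (degenerate eps s z)%:R%:E)%E.

Lemma integral_box_cst (r c : R) : 0 <= r -> 0 <= c ->
  (\int[leb2]_(z in box r) c%:E = (c * (2 * r) ^+ 2)%:E)%E.
Proof.
move=> r0 c0; rewrite integral_cst; last exact: measurable_box.
by rewrite EFinM; congr (_ * _)%E; exact: box_measure.
Qed.

Lemma degenerate_area_fin (r eps : R) s : 0 <= r -> degenerate_area r eps s \is a fin_num.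
Proof.
move=> r0; rewrite ge0_fin_numE; last by apply: integral_ge0 => z _; rewrite lee_fin.
apply: (@le_lt_trans _ _ (\int[leb2]_(z in box r) 1%:E)%E).
  apply: ge0_le_integral => //; first exact: measurable_box.
  - by apply/measurable_EFinP; apply: measurable_funTS; exact: measurable_degenerate.
  - by move=> z _; rewrite lee_fin lern1; case: degenerate.
by rewrite integral_box_cst// ltry.
Qed.

(** Each of the fewer than [2 n] singularities contributes at most the area [(2 r) ^ 2] plus [16 r],
    wherever it lies. *)
Lemma integral_potential (r eps lam T L e : R) (s : seq C) :
  let n := (size s)%:R in let t := zeros (roots_poly s)^`() in
  0 <= eps -> 0 < lam -> 0 <= T -> 0 <= r -> 0 < e -> (0 < size s)%N ->
  (forall x : R, x != 0 -> - ln `|x| <= T + lam * (Num.sqrt `|x|)^-1) ->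
  \sum_(x <- s) log_plus `|x| <= L ->
  (\int[leb2]_(z in box r)
     `|\sum_(x <- t) logpot e x z - \sum_(x <- s) logpot e x z|%:E <=
   ((eps * n + ln n + T) * (2 * r) ^+ 2 +
    (n * (T + ln (1 + 2 * r) + ln 2) + L) * fine (degenerate_area r eps s) +
    (lam + 2 * Num.sqrt (Num.sqrt e)) * (2 * n) * ((2 * r) ^+ 2 + 16 * r))%:E)%E.
Proof.
move=> n t eps0 lam0 T0 r0 e0 s0 HT HL.
have [st sD] := deriv_roots_polyE s0.
have n1 : 1 <= n by rewrite ler1n.
have lnn : 0 <= ln n by rewrite ln_ge0.
set A := eps * n + ln n + T.
have A0 : 0 <= A by rewrite !addr_ge0// mulr_ge0// (le_trans _ n1).
set Bn := n * _ + L.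
have Bn0 : 0 <= Bn.
  rewrite addr_ge0//.
    rewrite mulr_ge0 ?(le_trans _ n1)// !addr_ge0// ln_ge0// ?lerDl ?mulr_ge0// ler1n//.
  apply: le_trans HL; apply: sumr_ge0 => x _.
  by rewrite /log_plus le_max lexx orbT.
set tau := lam + _.
have tau0 : 0 < tau by rewrite ltr_pwDl// mulr_ge0// sqrtr_ge0.
have mB : measurable (box r : set (R * R)) by exact: measurable_box.
have mk (x : C) : measurable_fun setT (fun z : R * R => kappa (z.1 - complex.Re x)).
  apply: (measurableT_comp measurable_kappa).
  by apply: measurable_funB => //; exact: measurable_fst.
have m1k (x : C) : measurable_fun (box r) (fun z : R * R => 1 + kappa (z.1 - complex.Re x))%E.
  by apply: measurable_funTS; apply: emeasurable_funD => //; exact: mk.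
have mS : measurable_fun (box r)
    (fun z : R * R => (\sum_(x <- s ++ t) (1 + kappa (z.1 - complex.Re x)))%E).
  by apply: emeasurable_sum => x; exact: m1k.
have k10 (z : R * R) (x : C) : (0 <= 1 + kappa (z.1 - complex.Re x))%E.
  by rewrite adde_ge0// kappa_ge0.
have S0 (z : R * R) : (0 <= \sum_(x <- s ++ t) (1 + kappa (z.1 - complex.Re x)))%E.
  by apply: sume_ge0 => x _.
have mlog (s' : seq C) : measurable_fun setT (fun z : R * R => \sum_(x <- s') logpot e x z).
  by apply: measurable_sum => x; exact: measurable_logpot.
have mdeg : measurable_fun (box r) (fun z : R * R => (degenerate eps s z)%:R%:E : \bar R).
  by apply/measurable_EFinP; apply: measurable_funTS; exact: measurable_degenerate.
apply: (@le_trans _ _ (\int[leb2]_(z in box r) (A%:E + Bn%:E * (degenerate eps s z)%:R%:E +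
    tau%:E * \sum_(x <- s ++ t) (1 + kappa (z.1 - complex.Re x))))%E).
  apply: ge0_le_integral => //.
  - apply/measurable_EFinP; apply: measurable_funTS; apply: measurableT_comp => //.
    by apply: measurable_funB; exact: mlog.
  - apply: emeasurable_funD; last exact: measurable_funeM.
    by apply: emeasurable_funD => //; exact: measurable_funeM.
  move=> z Bz.
  (* If [z] is on the vertical line of some singularity, the right-hand side is infinite by
     [kappa0], so the comparison holds at every point. *)
  have [/allP zst|/allPn[x xst]] := boolP (all (fun x : C => z.1 != complex.Re x) (s ++ t)).
    apply: (@le_trans _ _ (A + Bn * (degenerate eps s z)%:R +
        tau * \sum_(x <- s ++ t) (Num.sqrt `|z.1 - complex.Re x|)^-1)%:E).
      rewrite lee_fin; apply: potential_bound => //; first exact: ltW.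
      apply: norm_deriv_roots_poly => //; apply/negP => zs.
      by have := zst (plane z); rewrite mem_cat zs eqxx => /(_ isT).
    rewrite EFinD; apply: leeD; first by rewrite EFinD EFinM.
    rewrite EFinM; apply: lee_pmul => //.
    - by rewrite lee_fin ltW.
    - by rewrite lee_fin; apply: sumr_ge0 => x _; rewrite invr_ge0 sqrtr_ge0.
    rewrite -sumEFin big_seq [leRHS]big_seq; apply: lee_sum => x xst.
    by apply: kappaP; rewrite subr_eq0 zst.
  rewrite negbK => /eqP zx.
  suff -> : (\sum_(x <- s ++ t) (1 + kappa (z.1 - complex.Re x)) = +oo)%E.
    by rewrite gt0_muley ?lte_fin// addey ?leey// -EFinM.
  rewrite (big_rem x xst) /= zx subrr kappa0 addey// addye//.
  rewrite gt_eqF// (lt_le_trans ltNy0)//.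
  by apply: sume_ge0 => y _; rewrite adde_ge0// kappa_ge0.
rewrite ge0_integralD//; last 4 first.
- by move=> z _; apply: adde_ge0; rewrite ?lee_fin//; apply: mulr_ge0.
- by apply: emeasurable_funD => //; exact: measurable_funeM.
- by move=> z _; rewrite mule_ge0// lee_fin ltW.
- exact: measurable_funeM.
rewrite ge0_integralD//; last 2 first.
- by move=> z _; rewrite mule_ge0// lee_fin.
- exact: measurable_funeM.
rewrite integral_box_cst// ge0_integralZl_EFin// ge0_integralZl_EFin//; last exact: ltW.
set Z := (2 * r) ^+ 2 + 16 * r.
rewrite [leRHS](_ : _ = (A * (2 * r) ^+ 2)%:E + Bn%:E * degenerate_area r eps s +
    tau%:E * (2 * n * Z)%:E)%E; last first.
  rewrite -[degenerate_area r eps s in RHS]fineK ?degenerate_area_fin//.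
  by rewrite -!EFinM -!EFinD -(mulrA tau).
apply: leeD2l; apply: lee_pmul => //.
- by rewrite lee_fin ltW.
- by apply: integral_ge0.
rewrite ge0_integral_sum//.
apply: (@le_trans _ _ (\sum_(x <- s ++ t) ((2 * r) ^+ 2 + 16 * r)%:E)%E).
  apply: lee_sum => x _; rewrite ge0_integralD//; last 2 first.
  - by move=> z _; rewrite kappa_ge0.
  - by apply: measurable_funTS; exact: mk.
  rewrite integral_box_cst// mul1r EFinD leeD2l//.
  exact: integral_kappa_box.
rewrite sumEFin lee_fin big_const_seq count_predT iter_addr addr0 -[leLHS]mulr_natl.
rewrite ler_wpM2r ?addr_ge0 ?sqr_ge0 ?mulr_ge0//.
rewrite size_cat natrD mulr_natl mulr2n lerD2l ler_nat -st.
exact: leqnSn.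
Qed.

(** [mass e * f x] is close to the integral of [f] against the mollifier at [x], which Green's
    formula turns into that of the Laplacian of [f] against [logpot e x]. The potentials of [t] and
    [s] are subtracted before absolute values are taken. [9 / 8] is the inverse of the lower bound
    of [mass e]. *)
Lemma discrepancy (f fx fxx fy fyy : C -> R) (r M : R) (B : smooth_bump f fx fxx fy fyy r M)
    (delta e X : R) (s t : seq C) :
  0 < e -> e <= 1 -> 0 <= delta ->
  (forall c, exists I : R, (\int[leb2]_z (f (plane z) * mollifier e c z)%:E = I%:E)%E /\
      `|mass e * f c - I| <= delta * mass e) ->
  (\int[leb2]_(z in box r)
     `|\sum_(x <- t) logpot e x z - \sum_(x <- s) logpot e x z|%:E <= X%:E)%E ->
  `|\sum_(x <- t) f x - \sum_(x <- s) f x| <=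
    delta * ((size t)%:R + (size s)%:R) + 9 / 8 * (M * X).
Proof.
move=> e0 e1 d0 HI HX; have me := mass_ge e0 e1.
have r0 := ltW (bump_r B).
have m0 : 0 < mass e by apply: lt_le_trans me; rewrite divr_gt0.
pose I (c : C) : R := fine (\int[leb2]_z (f (plane z) * mollifier e c z)%:E)%E.
have IE c : (\int[leb2]_z (f (plane z) * mollifier e c z)%:E = (I c)%:E)%E.
  by have [J [EJ _]] := HI c; rewrite /I EJ.
have Ile c : `|mass e * f c - I c| <= delta * mass e.
  by have [J [EJ h]] := HI c; rewrite /I EJ.
pose Lf (z : R * R) := fxx (plane z) + fyy (plane z).
have mLf : measurable_fun setT Lf.
  by apply: measurable_funD; apply: measurable_plane; [exact: bump_cxx B|exact: bump_cyy B].
have LfM z : `|Lf z| <= M.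
  case: (bump_le B (plane z)) => _ _ _; apply: le_trans; exact: ler_normD.
have M0 : 0 <= M by exact: le_trans (LfM (0, 0)).
have Lf0 z : ~ box r z -> Lf z = 0.
  by move=> /(bump_box B)[_ _ h1 _ h2]; rewrite /Lf h1 h2 addr0.
have iLU c : leb2.-integrable setT (fun z => (Lf z * logpot e c z)%:E).
  have [N HN] := logpot_bound r c e0.
  apply: (@integrable_box _ r (M * N)) => //.
  - by apply: measurable_funM => //; exact: measurable_logpot.
  - by move=> z /HN h; rewrite normrM ler_pM.
  - by move=> z /Lf0 ->; rewrite mul0r.
have gr c : (\int[leb2]_z (Lf z * logpot e c z)%:E = (I c)%:E)%E.
  by rewrite -IE; exact: (green B c e0).
have iS (s' : seq C) : leb2.-integrable setT (fun z => (\sum_(x <- s') (Lf z * logpot e x z)%:E)%E).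
  by apply: integrable_sum.
have sumI (s' : seq C) :
    (\int[leb2]_z (\sum_(x <- s') (Lf z * logpot e x z)%:E) = (\sum_(x <- s') I x)%:E)%E.
  by rewrite integral_sum// -sumEFin; apply: eq_bigr => x _; exact: gr.
have diffI : `|\sum_(x <- t) I x - \sum_(x <- s) I x| <= M * X.
  rewrite -lee_fin -abse_EFin EFinB -!sumI -integralB//.
  apply: le_trans (le_abse_integral _ _ _) _ => //.
    by apply: emeasurable_funB; exact: measurable_int (iS _).
  have mL : measurable_fun setT (fun z : R * R =>
      `|\sum_(x <- t) logpot e x z - \sum_(x <- s) logpot e x z|%:E : \bar R).
    apply/measurable_EFinP; apply: measurableT_comp => //.
    by apply: measurable_funB; apply: measurable_sum => x; exact: measurable_logpot.
  apply: (@le_trans _ _ (M%:E * \int[leb2]_(z in box r)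
     `|\sum_(x <- t) logpot e x z - \sum_(x <- s) logpot e x z|%:E)%E); last first.
    by rewrite EFinM; apply: lee_wpmul2l.
  rewrite -ge0_integralZl_EFin//; [|exact: measurable_box|exact: measurable_funTS].
  rewrite [leRHS]integral_mkcond; apply: ge0_le_integral => //.
  - apply: measurableT_comp => //.
    by apply: emeasurable_funB; exact: measurable_int (iS _).
  - apply/(measurable_restrictT _ (measurable_box r)).
    by apply: measurable_funeM; exact: measurable_funTS.
  have Lsum z (s' : seq C) :
      \sum_(x <- s') Lf z * logpot e x z = Lf z * \sum_(x <- s') logpot e x z.
    by rewrite mulr_sumr.
  move=> z _; rewrite !sumEFin -EFinB abse_EFin !Lsum -mulrBr normrM patchE.
  case: ifPn => [_|]; first by rewrite -EFinM lee_fin ler_wpM2r.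
  by rewrite notin_setE => /Lf0 ->; rewrite normr0 mul0r.
have sumf (s' : seq C) : `|mass e * \sum_(x <- s') f x - \sum_(x <- s') I x| <=
    delta * mass e * (size s')%:R.
  rewrite mulr_sumr -sumrB; apply: le_trans (ler_norm_sum _ _ _) _.
  apply: (@le_trans _ _ (\sum_(x <- s') delta * mass e)); first by apply: ler_sum.
  by rewrite big_const_seq count_predT iter_addr addr0 mulr_natr.
have key : mass e * `|\sum_(x <- t) f x - \sum_(x <- s) f x| <=
    delta * mass e * ((size t)%:R + (size s)%:R) + M * X.
  rewrite -{1}(ger0_norm (ltW m0)) -normrM mulrBr.
  have := sumf s; have := sumf t; have := diffI.
  rewrite !ler_norml mulrDr.
  set a1 := mass e * _; set a2 := mass e * _; set D1 := delta * mass e * _.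
  set D2 := delta * mass e * _; set i1 := \sum_(x <- t) I x; set i2 := \sum_(x <- s) I x.
  set MX := M * X; clear; lra.
have MX0 : 0 <= M * X by exact: le_trans diffI.
rewrite -(ler_pM2l m0); apply: le_trans key _.
rewrite [leRHS](_ : _ = delta * mass e * ((size t)%:R + (size s)%:R) +
  mass e * (9 / 8) * (M * X)); last by ring.
by rewrite lerD2l -[leLHS]mul1r ler_wpM2r//; lra.
Qed.

End potential_integral.

(** * Average distance between zeros and critical points *)

Section critical_points.
Context {R : realType}.
Local Notation C := (Rcomplex R).
Local Notation leb := (@lebesgue_measure R).
Local Notation leb2 := (leb \x leb)%E.
Variables a b : nat -> C.
Hypothesis inf_neq : infinite_set [set k | a k != b k].

Let q (eps : R) n z := avg a b n (fun s => (degenerate eps s z)%:R : R).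

Lemma near_expRN (c delta : R) : 0 < c -> 0 < delta ->
  \forall n \near \oo, expR (- (c * n%:R)) < delta.
Proof.
move=> c0 d0; exists (Num.truncn (delta^-1 / c)).+1 => // n /= hn.
have hn' : delta^-1 / c < n%:R.
  by apply: lt_le_trans (truncnS_gt _) _; rewrite ler_nat.
rewrite expRN invf_plt ?posrE ?expR_gt0//.
apply: lt_le_trans (expR_ge1Dx _); rewrite ltr_wpDl//.
by rewrite mulrC -ltr_pdivrMr.
Qed.

(** The map [g] is injective, so the sum of the [(z - x)^-1] has infinitely many nondegenerate steps
    and [anti_concentration] applies with centre 0; [exp (- eps n)] ends up below its fixed
    radius. *)
Lemma avg_degenerate_cvg0 (eps : R) (z : R * R) : 0 < eps ->
  (forall k, plane z != a k) -> (forall k, plane z != b k) ->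
  q eps n z @[n --> \oo] --> 0.
Proof.
move=> eps0 za zb; apply/cvgr0Pnorm_le => eta eta0.
pose g (x : C) : C := (plane z - x)^-1.
have inf' : infinite_set [set k | (g \o a) k != (g \o b) k].
  apply: sub_infinite_set inf_neq => k /=; apply: contra => /eqP.
  by move=> /invr_inj /addrI /oppr_inj ->.
have [delta [K [d0 HK]]] := anti_concentration inf' eta0.
near=> n.
have nK : (K <= n)%N by near: n; exists K.
have n0 : (0 < n)%N by near: n; exists 1%N.
have nd : expR (- (eps * n%:R)) < delta by near: n; exact: near_expRN.
have q0 : 0 <= q eps n z by apply: avg_ge0.
rewrite ger0_norm//; apply: le_trans (HK n 0 nK).
rewrite (avg_map g); apply: le_avg => s sn.
have [ss sP] := choicesP sn.
case: (boolP (degenerate eps s z)) => // deg.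
suff -> : `|\sum_(x <- [seq g x | x <- s]) x - 0| < delta by [].
have zs x : x \in s -> 0 < `|plane z - x|.
  move=> xs; rewrite normr_gt0 subr_eq0 -(nth_index 0 xs).
  by have [->|->] := sP 0 (index x s) (eq_ind _ (fun m => index x s < m)%N
    (eq_ind_r (fun b : bool => b) xs (index_mem x s)) _ ss); [exact: za|exact: zb].
have [P0 _] := ln_prod zs.
rewrite subr0 big_map; apply: lt_trans nd.
rewrite -(ltr_pM2r P0) -norm_deriv_roots_poly ?ss//; first by move: deg; rewrite /degenerate ss.
by apply/negP => /zs; rewrite subrr normr0 ltxx.
Unshelve. all: by end_near. Qed.

Lemma negligible_plane_eq (c : C) : leb2.-negligible [set z | plane z = c].
Proof.
exists ([set complex.Re c] `*` [set complex.Im c]); split.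
- by apply: measurableX; exact: measurable_set1.
- rewrite product_measure1E; [|exact: measurable_set1..].
  transitivity (0 * leb [set complex.Im c])%E; last by rewrite mul0e.
  by congr (_ * _)%E; exact: lebesgue_measure_set1.
- by move=> z /= <-.
Qed.

(** The finite average commutes with the integral over the box, and dominated convergence applies:
    the pointwise limit is known except at the countably many points [a k] and [b k]. *)
Lemma avg_degenerate_area (r eps : R) : 0 <= r -> 0 < eps ->
  avg a b n (fun s => fine (degenerate_area r eps s)) @[n --> \oo] --> 0.
Proof.
move=> r0 eps0.
have mB := measurable_box r.
have mq n : measurable_fun setT (q eps n).
  apply: measurable_funM => //; apply: measurable_sum => s.
  exact: measurable_degenerate.
have qE n : (\int[leb2]_(z in box r) (q eps n z)%:E =
    (avg a b n (fun s => fine (degenerate_area r eps s)))%:E)%E.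
  rewrite /q /avg; under eq_integral do rewrite EFinM -sumEFin.
  rewrite ge0_integralZl_EFin//; last 2 first.
  - by move=> z _; apply: sume_ge0 => s _; rewrite lee_fin.
  - apply: emeasurable_sum => s; apply/measurable_EFinP; apply: measurable_funTS.
    exact: measurable_degenerate.
  rewrite ge0_integral_sum//; last first.
    by move=> s; apply/measurable_EFinP; apply: measurable_funTS; exact: measurable_degenerate.
  rewrite EFinM -sumEFin; congr (_ * _)%E; apply: eq_bigr => s _.
  by rewrite fineK// degenerate_area_fin.
have [|||||_ _] := @dominated_convergence _ _ _ leb2 (box r) mB
    (fun n z => (q eps n z)%:E) (cst 0%E) (cst 1%E).
- by move=> n; apply/measurable_EFinP; apply: measurable_funTS; exact: mq.
- exact: measurable_cst.
- pose N := \bigcup_k ([set z | plane z = a k] `|` [set z | plane z = b k]).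
  have nN : leb2.-negligible N.
    by apply: negligible_bigcup => k; apply: negligibleU; exact: negligible_plane_eq.
  apply: negligibleS nN => z /= /not_implyP[_ h]; apply: contrapT => nNz; apply: h.
  have := @avg_degenerate_cvg0 eps z eps0.
  have za k : plane z != a k by apply/eqP => e; apply: nNz; exists k => //; left.
  have zb k : plane z != b k by apply/eqP => e; apply: nNz; exists k => //; right.
  by move=> /(_ za zb) h; apply: cvg_EFin; [exact: nearW|exact: h].
- apply/integrableP; split; first exact: measurable_cst.
  by under eq_integral do rewrite gee0_abs//; rewrite integral_box_cst// ltry.
- apply: aeW => z n _; rewrite gee0_abs ?lee_fin; last by apply: avg_ge0.
  rewrite -[leRHS](avg_cst a b n); apply: le_avg => s _.
  by case: degenerate.
rewrite integral0 => h.
have : (avg a b n (fun s => fine (degenerate_area r eps s)))%:E @[n --> \oo] --> 0%:E.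
  by under eq_fun do rewrite -qE; exact: h.
by move/fine_cvgP => [].
Qed.

Lemma small_factor (c eta : R) : 0 <= c -> 0 < eta ->
  exists2 x, 0 < x & forall y, y <= x -> c * y <= eta.
Proof.
move=> c0 eta0; have c1 : 0 < c + 1 by rewrite ltr_wpDl.
exists (eta / (c + 1)); first by rewrite divr_gt0.
move=> y yx; apply: le_trans (ler_wpM2l c0 yx) _.
rewrite mulrCA ler_piMr ?(ltW eta0)// ler_pdivrMr// mul1r; lra.
Qed.

(** [ln n = 2 ln (sqrt n) <= 2 sqrt n], so the left-hand side is at most [(2 + T) sqrt n]. *)
Lemma near_ln_le (T x : R) : 0 <= T -> 0 < x ->
  \forall n \near \oo, ln n%:R + T <= x * n%:R.
Proof.
move=> T0 x0; near=> n.
have n1 : 1 <= n%:R :> R by near: n; exists 1%N => // n /= h; rewrite ler1n.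
have n0 : 0 < n%:R :> R by exact: lt_le_trans n1.
have nx : ((2 + T) / x) ^+ 2 <= n%:R.
  near: n; exists (Num.truncn (((2 + T) / x) ^+ 2)).+1 => // n /= h.
  by apply: le_trans (ltW (truncnS_gt _)) _; rewrite ler_nat.
set y : R := Num.sqrt n%:R.
have y0 : 0 < y by rewrite sqrtr_gt0.
have yn : n%:R = y ^+ 2 by rewrite sqr_sqrtr.
have y1 : 1 <= y by rewrite -sqrtr1 ler_wsqrtr.
have xy : 2 + T <= x * y.
  rewrite mulrC -ler_pdivrMr// -[leLHS]ger0_norm ?divr_ge0 ?addr_ge0// ?(ltW x0)//.
  by rewrite -sqrtr_sqr ler_wsqrtr.
have lny : ln y <= y by apply/ltW/ln_sublinear.
rewrite yn lnXn// -[ln y *+ 2]mulr_natl; nra.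
Unshelve. all: by end_near. Qed.

Hypotheses (log_a : log_cesaro_bounded a) (log_b : log_cesaro_bounded b).

Lemma log_cesaro_le (c : nat -> C) : log_cesaro_bounded c ->
  exists2 L : R, 0 <= L & forall n, \sum_(k < n) log_plus `|c k| <= L * n%:R.
Proof.
move=> [M [_ HM]]; exists (`|M| + 1); first by rewrite addr_ge0.
case=> [|n]; first by rewrite big_ord0 mulr0.
have MM : M < `|M| + 1 by rewrite (le_lt_trans (ler_norm M))// ltrDl.
have := HM _ MM n I => /= /(le_trans (ler_norm _)).
by rewrite ler_pdivrMl// mulrC.
Qed.

(** The [log_plus] of an entry is at most the sum over its two candidates, so the bound holds for
    all choices at once and remains available on the degenerate event. *)
Lemma choices_log_le : exists2 L : R, 0 <= L & forall n s, s \in choices a b n ->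
  \sum_(x <- s) log_plus `|x| <= L * n%:R.
Proof.
have [La La0 Ha] := log_cesaro_le log_a; have [Lb Lb0 Hb] := log_cesaro_le log_b.
exists (La + Lb); first by rewrite addr_ge0.
move=> n s sn; rewrite mulrDl; apply: le_trans (lerD (Ha n) (Hb n)).
have lp0 (x : R) : 0 <= log_plus x by rewrite /log_plus le_max lexx orbT.
have [ss sP] := choicesP sn.
rewrite -big_split /= (big_nth 0) ss big_mkord; apply: ler_sum => k _.
by have [->|->] := sP 0 k (ltn_ord k); [rewrite lerDl|rewrite lerDr].
Qed.

(** The order of the parameters matters: [e1] from the mollification and [x1], which fix [lam] and
    [e]; then [T] and [c2], which depend on [lam]; then the tolerance [x4] on the degenerate area;
    last [n]. *)
Lemma avg_discrepancy (f : C -> R) (eta : R) : test_function f -> 0 < eta ->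
  \forall n \near \oo, avg a b n (fun s => `|\sum_(x <- zeros (roots_poly s)^`()) f x -
    \sum_(x <- s) f x|) <= eta * n%:R.
Proof.
move=> /test_function_bump[fx [fxx [fy [fyy [r [M B]]]]]] eta0.
have r0 := ltW (bump_r B).
have M0 : 0 <= M.
  by case: (bump_le B 0) => h _ _ _; exact: le_trans h.
have [L L0 HL] := choices_log_le.
have e8 : 0 < eta / 8 by rewrite divr_gt0.
have [e1 [e10 e11 Happrox]] := mollifier_approx B e8.
pose c1 := 9 / 8 * M; have c10 : 0 <= c1 by rewrite mulr_ge0// divr_ge0.
pose Q := (2 * r) ^+ 2; have Q0 : 0 <= Q by rewrite sqr_ge0.
pose Z := Q + 16 * r; have Z0 : 0 <= Z by rewrite addr_ge0// mulr_ge0.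
have [x1 x10 Hx1] := small_factor (mulr_ge0 c10 (mulr_ge0 (ler0n R 2) Z0)) e8.
have [eps eps0 Heps] := small_factor (mulr_ge0 c10 Q0) e8.
pose lam := x1 / 2; have lam0 : 0 < lam by rewrite divr_gt0.
(* The exponent 4 undoes the fourth root in [logpot_kappa]: the regularization error gets one half
   of [x1], and [lam] is the other half. *)
pose e := Num.min e1 ((x1 / 4) ^+ 4).
have e0 : 0 < e by rewrite lt_min e10 exprn_gt0// divr_gt0.
have ee1 : e <= e1 by rewrite ge_min lexx.
have tau : lam + 2 * Num.sqrt (Num.sqrt e) <= x1.
  have : Num.sqrt (Num.sqrt e) <= x1 / 4.
    have x40 : 0 <= x1 / 4 by rewrite divr_ge0// ltW.
    rewrite -[leRHS]ger0_norm// -sqrtr_sqr ler_wsqrtr//.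
    rewrite -[leRHS]ger0_norm ?sqr_ge0// -sqrtr_sqr ler_wsqrtr// -exprM.
    by rewrite ge_min lexx orbT.
  by rewrite /lam; lra.
have [T T0 HT] := ln_kappa lam0.
pose c2 := T + ln (1 + 2 * r) + ln 2 + L.
have c20 : 0 <= c2.
  by rewrite !addr_ge0// ln_ge0// ?lerDl ?mulr_ge0// ler1n.
have [x3 x30 Hx3] := small_factor (mulr_ge0 c10 Q0) e8.
have [x4 x40 Hx4] := small_factor (mulr_ge0 c10 c20) e8.
near=> n.
have n0 : (0 < n)%N by near: n; exists 1%N.
have nn0 : 0 <= n%:R :> R by [].
have hln : ln n%:R + T <= x3 * n%:R by near: n; exact: near_ln_le.
have harea : avg a b n (fun s => fine (degenerate_area r eps s)) <= x4.
  near: n; have /cvgr0Pnorm_le/(_ x4 x40) := avg_degenerate_area r0 eps0.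
  by apply: filterS => n; apply: le_trans; exact: ler_norm.
(* Six parts [eta / 8 * n] will be spent: two on mollification, one each on [eps], on [ln n + T], on
   the singularities and on the degenerate area. *)
apply: (@le_trans _ _ (avg a b n (fun s => eta / 8 * (2 * n%:R) +
    c1 * ((eps * n%:R + ln n%:R + T) * Q + x1 * (2 * n%:R) * Z) +
    c1 * (n%:R * c2) * fine (degenerate_area r eps s)))).
  apply: le_avg => s sn; have [ss _] := choicesP sn.
  have s0 : (0 < size s)%N by rewrite ss.
  have [st _] := deriv_roots_polyE s0.
  have HX := integral_potential (ltW eps0) lam0 T0 r0 e0 s0 HT (HL n s sn).
  have := discrepancy B e0 (le_trans ee1 e11) (ltW e8)
    (fun c => Happrox e c e0 ee1) HX.
  move=> /le_trans; apply.
  have area0 : 0 <= fine (degenerate_area r eps s).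
    by rewrite fine_ge0//; apply: integral_ge0 => z _; rewrite lee_fin.
  rewrite ss -[leRHS]addrA; apply: lerD.
    rewrite ler_wpM2l ?(ltW e8)// mulr_natl mulr2n lerD2r ler_nat -ss -st.
    exact: leqnSn.
  rewrite [leRHS](_ : _ = 9 / 8 * (M * (((eps * n%:R + ln n%:R + T) * Q +
      x1 * (2 * n%:R) * Z) + n%:R * c2 * fine (degenerate_area r eps s)))); last first.
    by rewrite /c1; ring.
  apply: ler_wpM2l; first by rewrite divr_ge0.
  apply: ler_wpM2l => //; rewrite -/Q -/Z addrAC; apply: lerD.
    by rewrite lerD2l ler_wpM2r// ler_wpM2r// mulr_ge0.
  by rewrite ler_wpM2r// (mulrC L) -mulrDr.
rewrite avgD avgZ avg_cst.
have := Hx1 x1 (lexx _); have := Heps eps (lexx _); have := Hx3 x3 (lexx _).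
have := Hx4 _ harea.
set A := avg _ _ _ _; move=> h4 h3 h2 h1.
have lnT : c1 * Q * (ln n%:R + T) <= c1 * Q * (x3 * n%:R).
  by rewrite ler_wpM2l// mulr_ge0.
have h4' := ler_wpM2r nn0 h4; have h3' := ler_wpM2r nn0 h3.
have h2' := ler_wpM2r nn0 h2; have h1' := ler_wpM2r nn0 h1.
have -> : eta / 8 * (2 * n%:R) +
    c1 * ((eps * n%:R + ln n%:R + T) * Q + x1 * (2 * n%:R) * Z) + c1 * (n%:R * c2) * A =
  2 * (eta / 8 * n%:R) + c1 * Q * eps * n%:R + c1 * Q * (ln n%:R + T) +
  c1 * (2 * Z) * x1 * n%:R + c1 * c2 * A * n%:R by ring.
have en : 0 <= eta * n%:R by rewrite mulr_ge0// ltW.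
have -> : eta * n%:R = 8 * (eta / 8 * n%:R) by field.
have en' : 0 <= eta / 8 * n%:R by rewrite mulr_ge0// ltW.
move: lnT h4' h3' h2' h1' en'; clear; rewrite !mulrA; lra.
Unshelve. all: by end_near. Qed.

End critical_points.

(** * Convergence of the zero measures *)

Section strong_law.
Context {R : realType}.
Local Notation C := (Rcomplex R).
Context d (Omega : measurableType d) (P : probability Omega R)
  (a b : nat -> C) (xi : nat -> {RV P >-> C}).
Hypothesis (xi_indep : independent_RVs xi)
  (xi_law : forall k, equally_likely (xi k) (a k) (b k)).

Definition mean_sum (f : C -> R) n := \sum_(k < n) 2^-1 * (f (a k) + f (b k)).

(** The induction runs on a telescoping strengthening, since
    [1 / (x + 1) ^ 2 <= 1 / x - 1 / (x + 1)]. *)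
Lemma sum_inv_sqr_le n : \sum_(k < n) (k.+1%:R ^+ 2)^-1 <= 2 :> R.
Proof.
case: n => [|n]; first by rewrite big_ord0.
suff H : \sum_(k < n.+1) (k.+1%:R ^+ 2)^-1 <= 2 - n.+1%:R^-1 :> R.
  by apply: le_trans H _; rewrite gerBl.
elim: n => [|n IHn]; first by rewrite big_ord1 expr1n invr1; lra.
rewrite big_ord_recr /= -[n.+2%:R]natr1.
have : 0 < n.+1%:R :> R by rewrite ltr0n.
move: IHn; set x : R := n.+1%:R; set S := \sum_(k < n.+1) _ => IHn x0.
have x1 : 0 < x + 1 by lra.
suff : 0 <= x^-1 - (x + 1)^-1 - ((x + 1) ^+ 2)^-1.
  by move: IHn; move: (x^-1) ((x + 1)^-1) (((x + 1) ^+ 2)^-1) => u v t; lra.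
have -> : x^-1 - (x + 1)^-1 - ((x + 1) ^+ 2)^-1 = (x * (x + 1) ^+ 2)^-1.
  by field; rewrite !gt_eqF.
by rewrite invr_ge0 mulr_ge0 ?exprn_ge0// ltW.
Qed.

Lemma sum_mkseq (g : C -> R) (c : nat -> C) n :
  \sum_(x <- mkseq c n) g x = \sum_(k < n) g (c k).
Proof. by rewrite /mkseq big_map -[in iota 0 n](subn0 n) -/(index_iota 0 n) big_mkord. Qed.

Lemma strong_law_bounded (g : C -> R) (M : R) : (forall z, `|g z| <= M) ->
  {ae P, forall w, n.+1%:R^-1 * (\sum_(k < n.+1) g (xi k w) - mean_sum g n.+1)
    @[n --> \oo] --> 0}.
Proof.
move=> gM.
pose S n (s : seq C) := \sum_(x <- s) g x - mean_sum g n.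
pose good (l n : nat) (s : seq C) : bool := `|S n s| < l.+1%:R^-1 * n%:R.
have /choice[E HE] : forall ln : nat * nat, exists E : set Omega,
    [/\ measurable E, forall w, E w -> good ln.1 ln.2 (mkseq (fun k => xi k w) ln.2) &
      P E = (avg a b ln.2 (fun s => (good ln.1 ln.2 s)%:R))%:E].
  by move=> ln; exact: choices_event.
have M0 : 0 <= M by exact: le_trans (gM 0).
pose F l n := ~` E (l, n.+1).
have mF l n : measurable (F l n) by case: (HE (l, n.+1)) => mE _ _; exact: measurableC.
(* The fourth moment bound of [avg_centered_sum4] divided by the fourth power of the threshold; the
   countably many thresholds [1 / (l + 1)] suffice for a limit. *)
pose B l : R := 3 * M ^+ 4 * l.+1%:R ^+ 4.
have B0 l : 0 <= B l by rewrite !mulr_ge0// exprn_ge0.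
have PF l n : (P (F l n) <= (B l * (n.+1%:R ^+ 2)^-1)%:E)%E.
  case: (HE (l, n.+1)) => mE _ PE; rewrite /F probability_setC// PE /= -EFinB lee_fin.
  set e : R := l.+1%:R^-1 * n.+1%:R.
  have e0 : 0 < e by rewrite mulr_gt0.
  have -> : 1 - avg a b n.+1 (fun s => (good l n.+1 s)%:R) =
      avg a b n.+1 (fun s => (e ^+ 4 <= S n.+1 s ^+ 4)%R%:R) :> R.
    transitivity (avg a b n.+1 (fun s => 1 + -1 * (good l n.+1 s)%:R : R)).
      by rewrite avgD avgZ avg_cst mulN1r.
    apply: eq_avg => s _.
    have -> : (e ^+ 4 <= S n.+1 s ^+ 4) = ~~ good l n.+1 s.
      rewrite /good -leNgt -/e.
      rewrite [in LHS](exprM e 2 2) [in LHS](exprM (S n.+1 s) 2 2).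
      rewrite ler_sqr ?nnegrE ?sqr_ge0// -[S n.+1 s ^+ 2]real_normK ?num_real//.
      by rewrite ler_sqr ?nnegrE ?normr_ge0// ltW.
    by case: (good l n.+1 s); rewrite /= ?mulr0 ?addr0// mulr1 subrr.
  apply: le_trans (avg_markov _ _ _ _ _) _; first by rewrite exprn_gt0.
    by move=> s; rewrite (exprM _ 2 2) sqr_ge0.
  rewrite ler_pdivrMr ?exprn_gt0//.
  apply: le_trans (avg_centered_sum4 a b gM n.+1) _.
  rewrite le_eqVlt; apply/orP; left; apply/eqP.
  rewrite /B /e.
  have : n.+1%:R != 0 :> R by rewrite pnatr_eq0.
  have : l.+1%:R != 0 :> R by rewrite pnatr_eq0.
  by move: (l.+1%:R) (n.+1%:R) => x y x0 y0; field; rewrite x0 y0.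
have ae1 : {ae P, forall w, forall l, exists n0, forall n, (n0 <= n)%N ->
    good l n.+1 (mkseq (fun k => xi k w) n.+1)}.
  apply: ae_foralln => l.
  exists (lim_sup_set (F l)); split.
  - by apply: bigcap_measurable => // n _; apply: bigcup_measurable.
  - apply: lim_sup_set_cvg0 => //.
    apply: (@le_lt_trans _ _ (B l * 2)%:E); last by rewrite ltry.
    apply: lime_le; first by apply: is_cvg_nneseries => n _ _; exact: measure_ge0.
    apply: nearW => n.
    apply: (@le_trans _ _ (\sum_(0 <= i < n) (B l * (i.+1%:R ^+ 2)^-1)%:E)%E).
      by apply: lee_sum => i _; exact: PF.
    rewrite sumEFin lee_fin -mulr_sumr ler_wpM2l// big_mkord.
    exact: sum_inv_sqr_le.
  - move=> w /= H n _; apply: contrapT => nF; apply: H; exists n => j nj.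
    case: (HE (l, j.+1)) => _ + _; apply; apply: contrapT => nE.
    by apply: nF; exists j.
apply: filterS ae1 => w Hw; apply/cvgr0Pnorm_lt => eps eps0.
pose l := Num.truncn eps^-1.
have leps : l.+1%:R^-1 < eps by rewrite invf_plt ?posrE// truncnS_gt.
have [n0 Hn0] := Hw l; exists n0 => // n /= /Hn0.
rewrite /good /S sum_mkseq => h.
rewrite normrM ger0_norm ?invr_ge0// mulrC ltr_pdivrMr//.
by apply: lt_trans h _; rewrite ltr_pM2r.
Qed.

End strong_law.

(** * Convergence in probability tested on functions *)

Section weak_probability.
Context {R : realType} d (Omega : measurableType d) (P : probability Omega R).
Local Notation C := (Rcomplex R).
Variables (nu : nat -> Omega -> probability C R) (mu : probability C R).

(** The sets reached with inner probability tending to 1 form a filter, since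
    [P (E n) + P (E' n) - 1] bounds the probability of the intersection from below. Its convergence
    to [mu] in an initial topology may be checked on one test function at a time. *)
Lemma weak_cvg_in_probabilityP :
  (forall f e, test_function f -> 0 < e -> exists E : nat -> set Omega,
    [/\ forall n, measurable (E n),
        forall n w, E n w -> `|\int[mu]_z f z - \int[nu n w]_z f z| < e &
        P (E n) @[n --> \oo] --> 1%E]) ->
  weak_cvg_in_probability P nu mu.
Proof.
move=> H.
pose F : set_system (weak_space R) := [set N | exists E : nat -> set Omega,
    [/\ forall n, measurable (E n),
        forall n, E n `<=` nu n @^-1` N &
        P (E n) @[n --> \oo] --> 1%E]].
have FF : Filter F.
  split.
  - exists (fun=> setT); split => //.
    by rewrite (_ : (fun=> _) = cst 1%E); [exact: cvg_cst|apply/funext => n; exact: probability_setT].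
  - move=> N N' [E [mE EN PE]] [E' [mE' EN' PE']].
    exists (fun n => E n `&` E' n); split.
    + by move=> n; exact: measurableI.
    + by move=> n w [/EN ? /EN' ?].
    apply: (@squeeze_cvge _ _ _ _ (fun n => P (E n) + P (E' n) - 1)%E _ (cst 1%E)).
    + apply: nearW => n; apply/andP; split; last exact: probability_le1 (measurableI _ _ _ _).
      have fE (A : set Omega) : measurable A -> P A \is a fin_num by move=> mA; exact: fin_num_measure.
      have mI := measurableI _ _ (mE n) (mE' n).
      have fin' : (P (E' n) < +oo)%E by rewrite ltey_eq fE.
      have : (P (E n) + P (E' n) - P (E n `&` E' n) <= 1)%E.
        rewrite -(measureUfinr (mE n) (mE' n) fin').
        exact: probability_le1 (measurableU _ _ (mE n) (mE' n)).
      have [x ->] : exists x, P (E n) = x%:E by exists (fine (P (E n))); rewrite fineK// fE.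
      have [y ->] : exists x, P (E' n) = x%:E by exists (fine (P (E' n))); rewrite fineK// fE.
      have [z ->] : exists x, P (E n `&` E' n) = x%:E.
        by exists (fine (P (E n `&` E' n))); rewrite fineK// fE.
      by rewrite -EFinD -!EFinB !lee_fin; lra.
    + rewrite [X in _ --> X](_ : _ = (1 + 1 - 1)%E); last first.
        by rewrite addeK.
      apply: cvgeB => //; last exact: cvg_cst.
      by apply: cvgeD.
    + exact: cvg_cst.
  - move=> N N' NN' [E [mE EN PE]]; exists E; split => // n w /EN; exact: NN'.
suff : F --> (mu : weak_space R) by apply.
apply/(@cvg_initial _ _ (@weak_pairing R)).
apply/cvg_sup => -[f tf]; apply/cvg_initial => /=.
apply/cvgrPdist_lt => e e0 /=.
have [E [mE EN PE]] := H f e tf e0.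
by exists E; split => // n w /EN.
Qed.

End weak_probability.

(** * Approximation by finitely many grid cells *)

Section step_approximation.
Context {R : realType}.
Local Notation C := (Rcomplex R).

Definition deviation (a b c : nat -> C) (g : C -> R) n : R :=
  n.+1%:R^-1 * (\sum_(k < n.+1) g (c k) - mean_sum a b g n.+1).

Variables a b c : nat -> C.
Local Notation D := (deviation a b c).

Lemma deviationE g n : D g n =
  n.+1%:R^-1 * \sum_(k < n.+1) (g (c k) - 2^-1 * (g (a k) + g (b k))).
Proof. by rewrite /deviation /mean_sum -sumrB. Qed.

Lemma deviation_lin x g h n : D (fun z => x * g z + h z) n = x * D g n + D h n.
Proof.
rewrite !deviationE mulrCA -mulrDr; congr (_ * _).
by rewrite mulr_sumr -big_split; apply: eq_bigr => k _ /=; ring.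
Qed.

(** The factor 2 counts one error at the points [c k] and one in the mean. *)
Lemma deviation_close g h e n : (forall z, `|g z - h z| <= e) ->
  `|D g n - D h n| <= 2 * e.
Proof.
move=> gh; rewrite !deviationE -mulrBr -sumrB normrM ger0_norm ?invr_ge0//.
rewrite ler_pdivrMl//.
have -> : n.+1%:R * (2 * e) = \sum_(k < n.+1) 2 * e by rewrite sumr_const card_ord -[RHS]mulr_natl.
apply: le_trans (ler_norm_sum _ _ _) (ler_sum _ _) => k _.
move: (gh (c k)) (gh (a k)) (gh (b k)); rewrite !ler_norml.
by move=> /andP[h1 h2] /andP[h3 h4] /andP[h5 h6]; apply/andP; split; lra.
Qed.

Lemma deviation_sum (I : Type) (L : seq I) (x : I -> R) (g : I -> C -> R) :
  (forall i, D (g i) n @[n --> \oo] --> 0) ->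
  D (fun z => \sum_(i <- L) x i * g i z) n @[n --> \oo] --> 0.
Proof.
move=> g0; elim: L => [|i L IHL].
  rewrite (_ : (fun n => _) = cst 0); first exact: cvg_cst.
  apply/funext => n; rewrite deviationE big1 ?mulr0// => k _.
  by rewrite !big_nil addr0 mulr0 subrr.
rewrite (_ : (fun n => _) = (fun n => x i * D (g i) n + D (fun z => \sum_(i <- L) x i * g i z) n)).
  rewrite -[X in _ --> X](addr0 0) -[X in _ --> X + _](mulr0 (x i)).
  by apply: cvgD => //; apply: cvgMr; exact: g0.
apply/funext => n; rewrite -deviation_lin; congr (D _ n).
by apply/funext => z; rewrite big_cons.
Qed.

Definition cell_index (m : nat) (z : C) : int * int :=
  (Num.floor (m.+1%:R * complex.Re z), Num.floor (m.+1%:R * complex.Im z)).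

Definition cell_corner (m : nat) (p : int * int) : C :=
  Complex (p.1%:~R / m.+1%:R) (p.2%:~R / m.+1%:R).

Lemma floor_approx (m : nat) (x : R) :
  `|x - (Num.floor (m.+1%:R * x))%:~R / m.+1%:R| <= m.+1%:R^-1.
Proof.
have := floor_itv (m.+1%:R * x); rewrite intrD1.
have : 0 < m.+1%:R :> R by rewrite ltr0n.
move: (m.+1%:R) ((Num.floor _)%:~R : R) => N k N0 /andP[h1 h2].
have -> : x - k / N = (N * x - k) / N by field; rewrite gt_eqF.
have N1 : 0 <= N^-1 by rewrite invr_ge0 ltW.
rewrite normrM (ger0_norm N1) -[leRHS]mul1r.
by rewrite ler_wpM2r// ler_norml; apply/andP; split; lra.
Qed.

Definition int_range (K : nat) : seq int := [seq Posz k - Posz K | k <- iota 0 (K + K).+1].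

Lemma mem_int_range K i : (i \in int_range K) = (`|i| <= Posz K)%R.
Proof.
apply/mapP/idP => [[k]|iK].
  by rewrite mem_iota => + ->; lia.
by exists (absz (i + Posz K)); rewrite ?mem_iota; lia.
Qed.

(** Moving [z] to the corner of its cell changes each coordinate by at most [1 / (m + 1)], whence
    two Lipschitz terms. Cells outside the finite list have corners of modulus at least [r], where
    [f] vanishes. *)
Lemma step_approx f fx fxx fy fyy (r M : R) m : smooth_bump f fx fxx fy fyy r M ->
  exists L : seq (int * int), forall z, `|f z - \sum_(p <- L) f (cell_corner m p) *
    (cell_index m z == p)%:R| <= 2 * M / m.+1%:R.
Proof.
move=> B; pose K := (Num.truncn (r * m.+1%:R)).+1.
pose L := undup [seq (i, j) | i <- int_range K, j <- int_range K].
have M0 : 0 <= M by case: (bump_le B 0) => + _ _ _; apply: le_trans.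
exists L => z; set p := cell_index m z.
have -> : \sum_(q <- L) f (cell_corner m q) * (p == q)%:R = f (cell_corner m p).
  have [pL|pL] := boolP (p \in L).
    rewrite (bigD1_seq p) ?undup_uniq//= eqxx mulr1 big1 ?addr0// => q qp.
    by rewrite eq_sym (negbTE qp) mulr0.
  rewrite big1_seq => [|q /= qL]; last first.
    by case: eqP => [pq|_]; rewrite ?mulr0//; move: pL; rewrite pq qL.
  have N0 : 0 < m.+1%:R :> R by rewrite ltr0n.
  have far (i : int) : i \notin int_range K -> r <= `|i%:~R / m.+1%:R : R|.
    rewrite mem_int_range -ltNge => Ki.
    have N1 : 0 <= m.+1%:R^-1 :> R by rewrite invr_ge0 ltW.
    rewrite normrM (ger0_norm N1) ler_pdivlMr//.
    apply/ltW/(lt_trans (truncnS_gt _)); rewrite -/K -intr_norm.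
    by rewrite -[K%:R]/(K%:Z%:~R) ltr_int.
  suff rp : r <= `|cell_corner m p| by case: (bump_out B rp) => ->.
  have : ~~ ((p.1 \in int_range K) && (p.2 \in int_range K)).
    apply: contra pL => /andP[p1 p2].
    by rewrite mem_undup [p]surjective_pairing; exact: allpairs_f.
  rewrite negb_and => /orP[]/far /le_trans; apply.
    exact: (ler_Re_normc (cell_corner m p)).
  exact: (ler_Im_normc (cell_corner m p)).
case: z @p => x y p.
have := bump_lipschitz B (x, y) (cell_corner m p); rewrite /plane /=.
move/le_trans; apply.
have -> : 2 * M / m.+1%:R = M * (m.+1%:R^-1 + m.+1%:R^-1) by ring.
rewrite ler_wpM2l//.
by apply: lerD; exact: floor_approx.
Qed.

End step_approximation.

(** * Convergence of both zero measures *)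

Section zero_measures.
Context {R : realType}.
Local Notation C := (Rcomplex R).
Variables (mu : probability C R) (a b : nat -> C).
Hypotheses (mu_a : distributed mu a) (mu_b : distributed mu b).

Lemma integral_zero_measure (f : C -> R) (M : R) s : (0 < size s)%N ->
  continuous f -> (forall z, `|f z| <= M) ->
  \int[zero_measure (roots_poly s)]_z f z = (size s)%:R^-1 * \sum_(x <- s) f x.
Proof.
move=> s0 cf fM; rewrite /zero_measure (integral_empirical _ cf fM).
  by rewrite (perm_size (perm_zeros s)) (perm_big _ (perm_zeros s)).
by rewrite (perm_size (perm_zeros s)).
Qed.

Lemma test_function_continuous (f : C -> R) : test_function f -> continuous f.
Proof. by move=> [/(_ 0%N)]. Qed.

Lemma test_function_bounded (f : C -> R) : test_function f ->
  exists2 M, 0 < M & forall z, `|f z| <= M.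
Proof.
move=> /test_function_bump[fx [fxx [fy [fyy [r [M B]]]]]].
have M0 : 0 <= M by case: (bump_le B 0) => + _ _ _; apply: le_trans.
exists (M + 1) => [|z]; first by rewrite ltr_wpDl.
by case: (bump_le B z) => + _ _ _; move=> /le_trans; apply; rewrite lerDl.
Qed.

Lemma mean_sum_cvg f : test_function f ->
  n.+1%:R^-1 * mean_sum a b f n.+1 @[n --> \oo] --> \int[mu]_z f z.
Proof.
move=> tf; have cf := test_function_continuous tf.
have [M M0 fM] := test_function_bounded tf.
have key c : distributed mu c ->
    n.+1%:R^-1 * \sum_(k < n.+1) f (c k) @[n --> \oo] --> \int[mu]_z f z.
  move=> /(_ f tf); rewrite -(@cvg_shiftS R^o).
  rewrite (_ : (fun n => _) = (fun n => n.+1%:R^-1 * \sum_(k < n.+1) f (c k)))//.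
  apply/funext => n; rewrite (integral_empirical _ cf fM) ?size_mkseq//.
  by rewrite sum_mkseq.
rewrite (_ : (fun n => _) = (fun n => 2^-1 * (n.+1%:R^-1 * \sum_(k < n.+1) f (a k) +
    n.+1%:R^-1 * \sum_(k < n.+1) f (b k)))); last first.
  by apply/funext => n; rewrite /mean_sum -mulr_sumr big_split /= mulrCA -mulrDr.
rewrite [X in _ --> X](_ : _ = 2^-1 * (\int[mu]_z f z + \int[mu]_z f z)); last by lra.
by apply: cvgMr; apply: cvgD; exact: key.
Qed.

Section almost_sure.
Context d (Omega : measurableType d) (P : probability Omega R).
Variable xi : nat -> {RV P >-> C}.
Hypothesis (xi_indep : independent_RVs xi)
  (xi_law : forall k, equally_likely (xi k) (a k) (b k)).

Lemma roots_poly_mkseq (c : nat -> C) n :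
  \prod_(k < n) ('X - (c k)%:P) = roots_poly (mkseq c n).
Proof.
by rewrite /roots_poly /mkseq big_map -[in iota 0 n](subn0 n) -/(index_iota 0 n) big_mkord.
Qed.

(** One almost sure event must serve all test functions. It is the intersection of those for the
    countably many cell indicators, enumerated by [unpickle]; every test function is uniformly close
    to a finite combination of them. *)
Lemma ae_deviation : {ae P, forall w, forall f, test_function f ->
  deviation a b (fun k => xi k w) f n @[n --> \oo] --> 0}.
Proof.
pose g m p (z : C) : R := (cell_index m z == p)%:R.
have : {ae P, forall w, forall i : nat, if @choice.unpickle (nat * (int * int))%type i is Some mp
    then deviation a b (fun k => xi k w) (g mp.1 mp.2) n @[n --> \oo] --> 0 else True}.
  apply: ae_foralln => i; case: choice.unpickle => [mp|]; last exact/aeW.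
  apply: (strong_law_bounded xi_indep xi_law (g := g mp.1 mp.2) (M := 1)) => z.
  by rewrite /g; case: eqP; rewrite ?normr1 ?normr0.
apply: filterS => w Hw f tf.
have {}Hw m p : deviation a b (fun k => xi k w) (g m p) n @[n --> \oo] --> 0.
  by have := Hw (choice.pickle (m, p)); rewrite choice.pickleK.
have [fx [fxx [fy [fyy [r [M B]]]]]] := test_function_bump tf.
have M0 : 0 <= M by case: (bump_le B 0) => + _ _ _; apply: le_trans.
apply/cvgr0Pnorm_lt => e e0.
pose m := Num.truncn (8 * M / e).
have me : 2 * (2 * M / m.+1%:R) < e / 2.
  have := truncnS_gt (8 * M / e); rewrite -/m.
  have : 0 < m.+1%:R :> R by [].
  move: (m.+1%:R : R) => N N0; rewrite ltr_pdivrMr// mulrA ltr_pdivrMr// => h.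
  lra.
have [L HL] := step_approx m B.
have e2 : 0 < e / 2 by rewrite divr_gt0.
have := deviation_sum L (fun p => f (cell_corner m p)) (Hw m).
move=> /cvgr0Pnorm_lt /(_ _ e2).
apply: filterS => n hn.
have := deviation_close a b (fun k => xi k w) n HL.
move: hn; set u := deviation _ _ _ _ n; set v := deviation _ _ _ f n => hn h.
rewrite -[v](subrK u); apply: le_lt_trans (ler_normD _ _) _.
by apply: lt_le_trans (ltr_leD (le_lt_trans h me) (ltW hn)) _; lra.
Qed.

Lemma zero_measure_as :
  weak_cvg_as P (fun n w => zero_measure (\prod_(k < n) ('X - (xi k w)%:P))) mu.
Proof.
apply: filterS ae_deviation => w Hw f tf.
have cf := test_function_continuous tf.
have [M M0 fM] := test_function_bounded tf.
rewrite -(@cvg_shiftS R^o).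
rewrite (_ : (fun n => _) = (fun n => deviation a b (fun k => xi k w) f n +
    n.+1%:R^-1 * mean_sum a b f n.+1)).
  by have := cvgD (Hw f tf) (mean_sum_cvg tf); rewrite add0r => H; exact: H.
apply/funext => n; rewrite (roots_poly_mkseq (fun k => xi k w)).
rewrite (integral_zero_measure _ cf fM) ?size_mkseq//.
by rewrite sum_mkseq /deviation -mulrDr subrK.
Qed.

End almost_sure.

Hypotheses (log_a : log_cesaro_bounded a) (log_b : log_cesaro_bounded b).
Hypothesis neq_ab : infinite_set [set k | a k != b k].

(** Four errors are kept below [e / 4]: the mean against [mu], the fluctuation of the sum, the gap
    between zeros and critical points, and the normalization by [n - 1] instead of [n]. Only the
    second and third are random, and each fails with weight at most [eps / 4]. *)
Lemma avg_zero_measure_cvg f (e : R) : test_function f -> 0 < e ->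
  avg a b n (fun s => (`|\int[mu]_z f z - \int[zero_measure (roots_poly s)^`()]_z f z| < e)%R%:R : R)
    @[n --> \oo] --> (1 : R).
Proof.
move=> tf e0; have cf := test_function_continuous tf.
have [M M0 fM] := test_function_bounded tf.
set I := \int[mu]_z f z.
pose good s := `|I - \int[zero_measure (roots_poly s)^`()]_z f z| < e.
pose S n (s : seq C) := \sum_(x <- s) f x - mean_sum a b f n.
pose T (s : seq C) := `|\sum_(x <- zeros (roots_poly s)^`()) f x - \sum_(x <- s) f x|.
have e4 : 0 < e / 4 by rewrite divr_gt0.
apply/cvgrPdist_lt => eps eps0.
(* Markov's inequality at level [n * (e / 4)] turns this constant into [eps / 4]. *)
have eta0 : 0 < eps * e / 16 by rewrite !mulr_gt0.
have H1 := avg_discrepancy neq_ab log_a log_b tf eta0.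
have H2 : \forall n \near \oo, `|I - n%:R^-1 * mean_sum a b f n| < e / 4.
  have /cvgrPdist_lt/(_ _ e4) := mean_sum_cvg tf.
  by move=> [N _ HN]; exists N.+1 => // -[//|n] /= ?; exact: HN.
have H3 (K : R) : \forall n \near \oo, K < n%:R :> R.
  exists (Num.truncn K).+1 => // n /= hn; apply: lt_le_trans (truncnS_gt _) _.
  by rewrite ler_nat.
near=> n.
have n2 : (1 < n)%N by rewrite -(ltr_nat R); near: n; exact: H3.
have n0 : 0 < n%:R :> R by rewrite ltr0n ltnW.
have Mn : M / n%:R < e / 4.
  rewrite ltr_pdivrMr// mulrC -ltr_pdivrMr//; near: n; exact: H3.
pose A s : R := (n%:R * (e / 4) <= T s)%R%:R.
pose B s : R := ((n%:R * (e / 4)) ^+ 2 <= S n s ^+ 2)%R%:R.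
have A_le : avg a b n A <= eps / 4.
  apply: le_trans (avg_markov _ _ _ _ _) _ => //; first by rewrite mulr_gt0.
    by move=> s; rewrite /T.
  rewrite ler_pdivrMr ?mulr_gt0//.
  have -> : eps / 4 * (n%:R * (e / 4)) = eps * e / 16 * n%:R by lra.
  by near: n.
have B_le : avg a b n B <= eps / 4.
  apply: le_trans (avg_markov _ _ _ _ _) _ => //; first by rewrite exprn_gt0 ?mulr_gt0.
    by move=> s; rewrite sqr_ge0.
  rewrite ler_pdivrMr ?exprn_gt0 ?mulr_gt0//.
  apply: le_trans (avg_centered_sum2 a b fM n) _.
  have -> : eps / 4 * (n%:R * (e / 4)) ^+ 2 = n%:R * ((eps / 4 * (e / 4) ^+ 2) * n%:R) by ring.
  rewrite ler_wpM2l// mulrC -ler_pdivrMr ?mulr_gt0 ?exprn_gt0//.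
  apply/ltW; near: n; exact: H3.
have good_le : 1 <= avg a b n (fun s => (good s)%:R) + avg a b n A + avg a b n B.
  rewrite -!avgD -[leLHS](avg_cst a b n 1); apply: le_avg => s /choicesP[ss _].
  rewrite /A /B; case: (leP (n%:R * (e / 4)) (T s)) => h1 /=; first by rewrite -addrA addrCA lerDl addr_ge0.
  case: (leP ((n%:R * (e / 4)) ^+ 2) (S n s ^+ 2)) => h2 /=; first by rewrite addr0 lerDr.
  suff -> : good s by rewrite !addr0.
  have s0 : (0 < size s)%N by rewrite ss ltnW.
  have [st _] := deriv_roots_polyE s0.
  have t0 : (0 < size (zeros (roots_poly s)^`()))%N by rewrite -ltnS st ss.
  rewrite /good /zero_measure (integral_empirical t0 cf fM).
  move: h1; rewrite /T.
  set t := zeros _ in st t0 *; set U := \sum_(x <- t) f x => h1.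
  have UM : `|U| <= (size t)%:R * M.
    apply: le_trans (ler_norm_sum _ _ _) _.
    rewrite mulr_natl -[M *+ _]iter_addr_0 -count_predT -big_const_seq.
    by apply: ler_sum => x _; exact: fM.
  have {}h2 : `|S n s| < n%:R * (e / 4).
    by rewrite -ltr_sqr ?nnegrE ?normr_ge0 ?mulr_ge0 ?ltW// real_normK ?num_real.
  have HI : `|I - n%:R^-1 * mean_sum a b f n| < e / 4 by near: n.
  have nt : n%:R = (size t)%:R + 1 :> R by rewrite natr1 -ss -st.
  have {}t0 : 0 < (size t)%:R :> R by rewrite ltr0n.
  move: h1 h2 HI Mn UM n0; rewrite /S nt; move: ((size t)%:R : R) t0 => k k0.
  set m := mean_sum _ _ _ _; set V := \sum_(x <- s) f x => h1 h2 HI Mn UM n0.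
  have N0 : 0 <= (k + 1)^-1 by rewrite invr_ge0 ltW.
  have b1 : `|(k + 1)^-1 * (V - m)| < e / 4.
    by rewrite normrM (ger0_norm N0) ltr_pdivrMl.
  have b2 : `|(k + 1)^-1 * (U - V)| < e / 4.
    by rewrite normrM (ger0_norm N0) ltr_pdivrMl.
  (* With [k] critical points and [k + 1] zeros, the normalizations differ by [1 / (k (k + 1))], and
     [|U| <= k * M]. *)
  have b3 : `|k^-1 * U / (k + 1)| < e / 4.
    rewrite normrM (ger0_norm N0); apply: le_lt_trans Mn.
    by rewrite ler_wpM2r// normrM normfV (gtr0_norm k0) ler_pdivrMl.
  have -> : I - k^-1 * U = (I - (k + 1)^-1 * m) - (k + 1)^-1 * (V - m) -
      (k + 1)^-1 * (U - V) - k^-1 * U / (k + 1) by field; rewrite !gt_eqF.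
  move: HI b1 b2 b3; rewrite !ltr_norml.
  move: (I - _) (_ * (V - m)) (_ * (U - V)) (k^-1 * U / _) => ? ? ? ?.
  move=> /andP[? ?] /andP[? ?] /andP[? ?] /andP[? ?]; apply/andP; split; lra.
have good1 : avg a b n (fun s => (good s)%:R) <= 1 :> R.
  by rewrite -[leRHS](avg_cst a b n 1); apply: le_avg => s _; case: (good s).
rewrite ger0_norm ?subr_ge0//.
rewrite -/good.
have : 0 < eps by [].
move: good_le A_le B_le; set x := avg _ _ _ _; set y := avg _ _ _ _; set z := avg _ _ _ _.
lra.
Unshelve. all: by end_near. Qed.

End zero_measures.

Unset Implicit Arguments.
Set Strict Implicit.

Theorem theorem1p7 (R : realType) (mu : probability (Rcomplex R) R)
    (a b : nat -> Rcomplex R)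
    (mu_a : distributed mu a) (mu_b : distributed mu b)
    (log_a : log_cesaro_bounded a) (log_b : log_cesaro_bounded b)
    (neq_ab : infinite_set [set k | a k != b k])
    (d : measure_display) (Omega : measurableType d) (P : probability Omega R)
    (xi : nat -> {RV P >-> Rcomplex R})
    (xi_indep : independent_RVs xi)
    (xi_law : forall k, equally_likely (xi k) (a k) (b k)) :
  let Pn (n : nat) (w : Omega) := \prod_(k < n) ('X - (xi k w)%:P) in
  weak_cvg_as P (fun n w => zero_measure (Pn n w)) mu /\
  weak_cvg_in_probability P (fun n w => zero_measure (Pn n w)^`()) mu.
Proof.
move=> Pn; split; first exact: zero_measure_as xi_indep xi_law.
apply: weak_cvg_in_probabilityP => f e tf e0.
pose good (s : seq (Rcomplex R)) :=
  `|\int[mu]_z f z - \int[zero_measure (roots_poly s)^`()]_z f z| < e.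
(* These measurable events inside the required one witness its inner probability, and their
   probabilities are the averages of [good]. *)
have /choice[E HE] n := choices_event xi_indep xi_law n good.
exists E; split => [n|n w Ew|]; first by have [] := HE n.
  have [_ /(_ w Ew) + _] := HE n.
  by rewrite /good -(roots_poly_mkseq (fun k => xi k w)).
rewrite (_ : (fun n => _) = (fun n => (avg a b n (fun s => (good s)%:R))%:E)).
  apply: cvg_EFin; first exact: nearW.
  exact: avg_zero_measure_cvg.
by apply/funext => n; have [] := HE n.
Qed.
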